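(* Let $(\mathfrak g=\mathfrak l\oplus\mathfrak u,\ t\in S^2(\mathfrak g)^{\mathfrak g})$ be a quadratic Lie algebra with a nondegenerate splitting ($t$ is not assumed nondegenerate). Let $c\in\mathbb C$ and, for $\lambda\in\mathfrak l^*$, set $$\rho_c(\lambda)=r_{\mathfrak l}^{\mathfrak g}(\lambda)+c\,\big(f(c\,\mathrm{ad}(\lambda^\vee))\otimes\mathrm{id}\big)(t),\qquad f(x)=-\frac1x+\pi\cot(\pi x),\quad \lambda^\vee=(\lambda\otimes\mathrm{id})(t).$$ Then $$\mathrm{CYB}(\rho_c)+\mathrm{Alt}(\mathrm d\rho_c)=-\pi^2c^2Z,\qquad Z=[t^{1,2},t^{2,3}].$$
   Context: All Lie algebras are finite dimensional over $\mathbb C$. Splitting: $\mathfrak g=\mathfrak l\oplus\mathfrak u$, $\mathfrak l$ a Lie subalgebra, $[\mathfrak l,\mathfrak u]\subset\mathfrak u$; it is nondegenerate if for generic $\lambda\in\mathfrak l^*$ the form $\omega(\lambda):(x,y)\mapsto\lambda([x,y]_{\mathfrak l})$ on $\mathfrak u$ is nondegenerate ($[x,y]_{\mathfrak l}$ is the projection to $\mathfrak l$ along $\mathfrak u$). Let $D_0=\det\omega\in S^{\dim\mathfrak u}(\mathfrak l)$. In this statement $r_{\mathfrak l}^{\mathfrak g}=\sum_iu_i\otimes v_i\otimes\ell_i\in\wedge^2(\mathfrak u)\otimes S^\cdot(\mathfrak l)[1/D_0]$ is the unique element with $\sum_i[x,u_i]_{\mathfrak l}\,\ell_i\otimes v_i=-1\otimes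 x$ in $S^\cdot(\mathfrak l)[1/D_0]\otimes\mathfrak u$ for all $x\in\mathfrak u$ (inverse of $\omega$ with this sign normalization). $\mathfrak l^*$ is viewed in $\mathfrak g^*$ as the annihilator of $\mathfrak u$. The function $f$ is regular at $0$, so $\rho_c\in\wedge^2(\mathfrak g)\otimes\widehat S^\cdot(\mathfrak l)[1/D_0]$ (formal functions on $\mathfrak l^*$, localized). $\mathrm{CYB}(\rho)=[\rho^{1,2},\rho^{1,3}]+[\rho^{1,2},\rho^{2,3}]+[\rho^{1,3},\rho^{2,3}]$; $\mathrm d(x\otimes y\otimes z_1\cdots z_l)=\sum_ix\otimes y\otimes z_i\otimes z_1\cdots\check z_i\cdots z_l$, extended to localizations by the Leibniz rule; $\mathrm{Alt}(\xi\otimes g)=(\xi+\xi^{2,3,1}+\xi^{3,1,2})\otimes g$ for $\xi\in\mathfrak g^{\otimes3}$ antisymmetric in two tensor factors. *)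

(* Defs.v *)
From HB Require Import structures.
From mathcomp Require Import all_boot all_order all_algebra.
From mathcomp Require Import boolp reals.
From mathcomp Require trigo.
From mathcomp Require Import complex.
From mathcomp Require Import mpoly ring.

Set Implicit Arguments.
Unset Strict Implicit.
Unset Printing Implicit Defensive.

Import Order.TTheory GRing.Theory Num.Theory.
Local Open Scope ring_scope.

(* Formal power series in n variables over F, given by their coefficients; for
   a vector space l with basis e_0, ..., e_(n-1) this is the completed
   symmetric algebra of l, the variable X_i being e_i seen as a function on
   the dual of l. *)
Record mfps (F : fieldType) (n : nat) := MFPS { mfps_coef :> 'X_{1..n} -> F }.

HB.instance Definition _ (F : fieldType) n := gen_eqMixin (mfps F n).
HB.instance Definition _ (F : fieldType) n := gen_choiceMixin (mfps F n).

Section PowerSeriesRing.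
Variables (F : fieldType) (n : nat).
Implicit Types (p q r : mfps F n) (m : 'X_{1..n}).

Lemma mfpsP p q : (forall m, p m = q m) -> p = q.
Proof. by case: p q => [p] [q] /= H; congr MFPS; apply/funext. Qed.

Definition mfps0 : mfps F n := MFPS (fun=> 0).
Definition mfps_add p q := MFPS (fun m => p m + q m).
Definition mfps_opp p := MFPS (fun m => - p m).

Fact mfps_addA : associative mfps_add.
Proof. by move=> p q r; apply/mfpsP => m /=; rewrite addrA. Qed.
Fact mfps_addC : commutative mfps_add.
Proof. by move=> p q; apply/mfpsP => m /=; rewrite addrC. Qed.
Fact mfps_add0 : left_id mfps0 mfps_add.
Proof. by move=> p; apply/mfpsP => m /=; rewrite add0r. Qed.
Fact mfps_addN : left_inverse mfps0 mfps_opp mfps_add.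
Proof. by move=> p; apply/mfpsP => m /=; rewrite addNr. Qed.

HB.instance Definition _ :=
  GRing.isZmodule.Build (mfps F n) mfps_addA mfps_addC mfps_add0 mfps_addN.

Lemma mfps_coefD p q m : (p + q) m = p m + q m. Proof. by []. Qed.
Lemma mfps_coefN p m : (- p) m = - p m. Proof. by []. Qed.
Lemma mfps_coefB p q m : (p - q) m = p m - q m. Proof. by []. Qed.
Lemma mfps_coef0 m : (0 : mfps F n) m = 0. Proof. by []. Qed.
Lemma mfps_coef_sum I (s : seq I) (P : pred I) (G : I -> mfps F n) m :
  (\sum_(i <- s | P i) G i) m = \sum_(i <- s | P i) G i m.
Proof. exact: (big_morph (fun p => mfps_coef p m) (fun p q => erefl) erefl). Qed.

Definition mfps_of (p : {mpoly F[n]}) : mfps F n := MFPS (fun m => p@_m).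

Definition mfps_mul p q : mfps F n := MFPS (fun m =>
  \sum_(k : 'X_{1..n < (mdeg m).+1, (mdeg m).+1} | m == (k.1 + k.2)%MM)
     p k.1 * q k.2).

Definition mfps_trunc d p : {mpoly F[n]} :=
  \sum_(m : 'X_{1..n < d.+1}) p m *: 'X_[m].

Lemma mfps_truncE d p m : (mdeg m <= d)%N -> (mfps_trunc d p)@_m = p m.
Proof. by move=> le; rewrite mcoeff_mpoly. Qed.

Lemma mfps_mulE d p q m : (mdeg m <= d)%N ->
  mfps_mul p q m = (mfps_trunc d p * mfps_trunc d q)@_m.
Proof.
move=> le; rewrite mcoeffM; apply: eq_bigr => -[k1 k2] /= _.
by rewrite !mfps_truncE // (leq_trans _ le) // -ltnS ?bmdeg.
Qed.

Lemma mcoeffM_loc (p q p' q' : {mpoly F[n]}) m :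
  (forall k, (mdeg k <= mdeg m)%N -> p@_k = p'@_k) ->
  (forall k, (mdeg k <= mdeg m)%N -> q@_k = q'@_k) ->
  (p * q)@_m = (p' * q')@_m.
Proof.
move=> Hp Hq; rewrite !mcoeffM; apply: eq_bigr => -[k1 k2] /= _.
by rewrite Hp ?Hq // -ltnS bmdeg.
Qed.

Fact mfps_mulA : associative mfps_mul.
Proof.
move=> p q r; apply/mfpsP => m; rewrite !(@mfps_mulE (mdeg m)) //.
rewrite (@mcoeffM_loc _ _ (mfps_trunc (mdeg m) p)
  (mfps_trunc (mdeg m) q * mfps_trunc (mdeg m) r)) //; last first.
  by move=> k le; rewrite mfps_truncE // (@mfps_mulE (mdeg m)).
rewrite mulrA; apply: mcoeffM_loc => // k le.
by rewrite mfps_truncE // (@mfps_mulE (mdeg m)).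
Qed.

Fact mfps_mulC : commutative mfps_mul.
Proof.
by move=> p q; apply/mfpsP => m; rewrite !(@mfps_mulE (mdeg m)) // mulrC.
Qed.

Fact mfps_mul1 : left_id (mfps_of 1) mfps_mul.
Proof.
move=> p; apply/mfpsP => m; rewrite (@mfps_mulE (mdeg m)) //.
rewrite (@mcoeffM_loc _ _ 1 (mfps_trunc (mdeg m) p)) ?mul1r ?mfps_truncE //.
by move=> k le; rewrite mfps_truncE.
Qed.

Fact mfps_mulDl : left_distributive mfps_mul mfps_add.
Proof.
move=> p q r; apply/mfpsP => m /=; rewrite -big_split /=.
by apply: eq_bigr => k _; rewrite mulrDl.
Qed.

Fact mfps_one_neq0 : mfps_of 1 != 0.
Proof.
apply/eqP => /(congr1 (fun p => mfps_coef p 0%MM)) /=.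
by rewrite mcoeff1 eqxx => /eqP; rewrite oner_eq0.
Qed.

HB.instance Definition _ := GRing.Zmodule_isComNzRing.Build (mfps F n)
  mfps_mulA mfps_mulC mfps_mul1 mfps_mulDl mfps_one_neq0.

Lemma mfps_coefM d p q m : (mdeg m <= d)%N ->
  (p * q) m = (mfps_trunc d p * mfps_trunc d q)@_m.
Proof. exact: mfps_mulE. Qed.

Fact mfps_of_is_zmod : zmod_morphism mfps_of.
Proof. by move=> p q; apply/mfpsP => m; rewrite mfps_coefB /= mcoeffB. Qed.

Fact mfps_of_is_monoid : monoid_morphism mfps_of.
Proof.
split=> // p q; apply/mfpsP => m; rewrite (@mfps_coefM (mdeg m)) //=.
by apply: mcoeffM_loc => k le; rewrite mfps_truncE.
Qed.

HB.instance Definition _ :=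
  GRing.isZmodMorphism.Build {mpoly F[n]} (mfps F n) mfps_of mfps_of_is_zmod.
HB.instance Definition _ :=
  GRing.isMonoidMorphism.Build {mpoly F[n]} (mfps F n) mfps_of mfps_of_is_monoid.

Lemma mfps_of_inj : injective mfps_of.
Proof. by move=> p q [/(congr1 (fun h => h _))] H; apply/mpolyP => m; rewrite H. Qed.

Definition mfps_unit : {pred mfps F n} := [pred p | `[< exists q, q * p = 1 >]].

Definition mfps_inv p : mfps F n :=
  if pselect (exists q, q * p = 1) is left e then projT1 (cid e) else p.

Fact mfps_mulVx : {in mfps_unit, left_inverse 1 mfps_inv *%R}.
Proof.
move=> p /asboolP ex; rewrite /mfps_inv; case: pselect => // e.
exact: projT2 (cid e).
Qed.

Fact mfps_unitPl p q : q * p = 1 -> mfps_unit p.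
Proof. by move=> e; apply/asboolP; exists q. Qed.

Fact mfps_inv_out : {in [predC mfps_unit], mfps_inv =1 id}.
Proof.
move=> p /asboolP nex; rewrite /mfps_inv; case: pselect => // e.
Qed.

HB.instance Definition _ := GRing.ComNzRing_hasMulInverse.Build (mfps F n)
  mfps_mulVx mfps_unitPl mfps_inv_out.

Lemma mcoeffM_mlast (P Q : {mpoly F[n]}) :
  (P * Q)@_(mlast P + mlast Q) = P@_(mlast P) * Q@_(mlast Q).
Proof.
set a := mlast P; set b := mlast Q.
have la : (mdeg a < (mdeg (a + b)%MM).+1)%N by rewrite ltnS mdegD leq_addr.
have lb : (mdeg b < (mdeg (a + b)%MM).+1)%N by rewrite ltnS mdegD leq_addl.
rewrite mcoeffM (bigD1 (BMultinom la, BMultinom lb)) //= big1 ?addr0 //.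
case=> k1 k2 /= /andP[/eqP eqm ne].
have [lt|le|eqa] := ltgtP (k1 : 'X_{1..n}) a.
- by rewrite mcoeff_lt_mlast ?mul0r.
- rewrite [Q@__]mcoeff_lt_mlast ?mulr0 // -/b.
  rewrite ltNge; apply/negP => leb.
  by have /lt_eqF/eqP := ltmc_le_add le leb; apply.
case/negP: ne; have := eqm; rewrite eqa => /eqP; rewrite eqm_add2l => /eqP eqb.
by rewrite xpair_eqE -!val_eqE /= eqa -eqb !eqxx.
Qed.

Fact mfps_integral p q : p * q = 0 -> (p == 0) || (q == 0).
Proof.
move=> pq0; rewrite -[_ || _]negbK negb_or; apply/negP => /andP[p0 q0].
have ex r : r != 0 -> exists m, r m != 0.
  move=> r0; apply/not_existsP => H; case/eqP: r0; apply/mfpsP => m.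
  by apply/eqP; apply: contrapT => /negP /H.
have [[a pa] [b qb]] := (ex p p0, ex q q0).
pose d := (mdeg a + mdeg b)%N.
have [la lb] : (mdeg a <= d)%N /\ (mdeg b <= d)%N by rewrite leq_addr leq_addl.
pose P := mfps_trunc d p; pose Q := mfps_trunc d q.
have Pa : a \in msupp P by rewrite mcoeff_msupp mfps_truncE.
have Qb : b \in msupp Q by rewrite mcoeff_msupp mfps_truncE.
have P0 : P != 0 by apply/eqP => e; rewrite e msupp0 in Pa.
have Q0 : Q != 0 by apply/eqP => e; rewrite e msupp0 in Qb.
have /(@mfps_coefM d p q) : (mdeg (mlast P + mlast Q)%MM <= d)%N.
  by rewrite mdegD leq_add // lemc_mdeg // mlast_lemc.
rewrite pq0 mcoeffM_mlast => /esym/eqP; rewrite mulf_eq0 -/P -/Q.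
by rewrite !mcoeff_eq0 !mlast_supp.
Qed.

HB.instance Definition _ :=
  GRing.ComUnitRing_isIntegral.Build (mfps F n) mfps_integral.

Lemma mfps_coef_expr_lt p k m : p 0%MM = 0 -> (mdeg m < k)%N -> (p ^+ k) m = 0.
Proof.
move=> p0; elim: k m => // k IHk m lt; rewrite exprS /=.
rewrite big1 // => -[k1 k2] /= /eqP em.
have [d0|d0] := posnP (mdeg k1).
  by have /eqP := d0; rewrite mdeg_eq0 => /eqP ->; rewrite p0 mul0r.
have dm : mdeg m = (mdeg k1 + mdeg k2)%N by rewrite -mdegD -em.
rewrite [X in _ * X]IHk ?mulr0 // -ltnS (leq_trans _ lt) // ltnS.
by apply: leq_trans (eq_leq (esym dm)); rewrite -[X in (X < _)%N]add0n ltn_add2r.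
Qed.

Lemma mfps_unitP p : p 0%MM != 0 -> p \is a GRing.unit.
Proof.
move=> p0; pose h := 1 - mfps_of (p 0%MM)^-1%:MP * p.
have Ec c m : (mfps_of c%:MP * p) m = c * p m.
  rewrite (@mfps_coefM (mdeg m)) // (@mcoeffM_loc _ _ c%:MP
    (mfps_trunc (mdeg m) p)) // ?mcoeffCM ?mfps_truncE //.
  by move=> k le; rewrite mfps_truncE.
have h0 : h 0%MM = 0.
  by rewrite mfps_coefB Ec mulVf //= mcoeff1 eqxx subrr.
pose v := MFPS (fun m => (\sum_(k < (mdeg m).+1) h ^+ k) m).
have Ev d m : (mdeg m <= d)%N -> v m = (\sum_(k < d.+1) h ^+ k) m.
  move=> le; rewrite /= !mfps_coef_sum -!(big_mkord xpredT (fun k => (h ^+ k) m)).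
  rewrite [RHS](big_cat_nat (n := (mdeg m).+1)) //= [X in _ + X]big_nat_cond.
  rewrite [X in _ + X]big1 ?addr0 // => k /andP[/andP[lt _] _].
  exact: mfps_coef_expr_lt.
have E1 : v * (1 - h) = 1.
  apply/mfpsP => m; pose d := mdeg m.
  have -> : (v * (1 - h)) m = ((\sum_(k < d.+1) h ^+ k) * (1 - h)) m.
    rewrite !(@mfps_coefM d) //; apply: mcoeffM_loc => // k le.
    by rewrite !mfps_truncE // (@Ev d).
  rewrite mulrC -opprB mulNr -subrX1 opprB mfps_coefB.
  by rewrite mfps_coef_expr_lt ?subr0.
apply: (mfps_unitPl (q := v * mfps_of (p 0%MM)^-1%:MP)).
by rewrite -mulrA -E1 /h opprB addrC subrK.
Qed.

Definition mfps_deriv (i : 'I_n) p : mfps F n :=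
  MFPS (fun m => p (m + U_(i))%MM *+ (m i).+1).

Lemma mfps_derivM i p q :
  mfps_deriv i (p * q) = mfps_deriv i p * q + p * mfps_deriv i q.
Proof.
apply/mfpsP => m; rewrite mfps_coefD /mfps_deriv.
have dU : mdeg (m + U_(i))%MM = (mdeg m).+1 by rewrite mdegD mdeg1 addn1.
pose d := (mdeg m).+1.
have -> : MFPS (fun m => (p * q) (m + U_(i))%MM *+ (m i).+1) m
          = ((mfps_trunc d p * mfps_trunc d q)^`M(i))@_m.
  by rewrite mcoeff_deriv -(@mfps_coefM d) ?dU.
rewrite mderivM mcoeffD !(@mfps_coefM (mdeg m)) //.
have le1 k : (mdeg k <= mdeg m)%N -> (mdeg (k + U_(i))%MM <= (mdeg m).+1)%N.
  by move=> le; rewrite mdegD mdeg1 addn1.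
by congr (_ + _); apply: mcoeffM_loc => k le;
  rewrite ?mcoeff_deriv !mfps_truncE ?le1 // ltnW.
Qed.
End PowerSeriesRing.

(* As a ring of power series over a field is a domain, its localization at a
   nonzero D embeds in its field of fractions, and computations in the former
   are made in the latter. *)
Notation tofrac := (@FracField.tofrac _).

Section FractionDerivation.
Variables (F : fieldType) (n : nat).
Local Notation K := {fraction mfps F n}.

(* Quotient rule; frac_derivE shows independence of the representative. *)
Definition frac_deriv (i : 'I_n) (x : K) : K :=
  let a := \n_(repr x) in let b := \d_(repr x) in
  tofrac (mfps_deriv i a * b - a * mfps_deriv i b) / tofrac b ^+ 2.

Lemma frac_numden (x : K) : x = tofrac \n_(repr x) / tofrac \d_(repr x).
Proof.
have := reprK x; move: (repr x) => y <-.
have d0 : tofrac \d_y != 0 by rewrite tofrac_eq0 denom_ratioP.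
apply: (mulIf d0); rewrite divfK //.
unlock FracField.tofrac; rewrite -[LHS]FracField.pi_mul.
apply/eqP; rewrite eqmodE /= FracField.equivfE /FracField.mulf /=.
by rewrite !numden_Ratio ?mulr1 ?oner_eq0 ?denom_ratioP // mulrC.
Qed.

Lemma frac_derivE i (a b : mfps F n) : b != 0 ->
  frac_deriv i (tofrac a / tofrac b) =
  tofrac (mfps_deriv i a * b - a * mfps_deriv i b) / tofrac b ^+ 2.
Proof.
move=> b0; pose x := tofrac a / tofrac b; rewrite -/x /frac_deriv.
have := frac_numden x; have := denom_ratioP (repr x).
set c := \n_(repr x); set d := \d_(repr x) => d0.
have fb0 : tofrac b != 0 by rewrite tofrac_eq0.
have fd0 : tofrac d != 0 by rewrite tofrac_eq0.
rewrite {1}/x; move/eqP; rewrite eqr_div // -!tofracM tofrac_eq.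
move/eqP=> e.
have := congr1 (mfps_deriv i) e; rewrite !mfps_derivM => e'.
apply/eqP; rewrite eqr_div ?expf_neq0 // -!tofracXn -!tofracM tofrac_eq.
apply/eqP.
have -> : (mfps_deriv i a * b - a * mfps_deriv i b) * d ^+ 2 =
  b * d * (mfps_deriv i a * d + a * mfps_deriv i d)
  - d * mfps_deriv i b * (a * d) - b * mfps_deriv i d * (a * d).
  by ring.
rewrite e e'; ring.
Qed.
End FractionDerivation.

Record lie_bracket (F : fieldType) (g : vectType F) := LieBracket {
  lie_fun :> g -> g -> g;
  lie_linearl : forall y, linear (lie_fun^~ y);
  lie_linearr : forall x, linear (lie_fun x);
  lie_alt : forall x, lie_fun x x = 0;
  lie_jacobi : forall x y z,
    lie_fun x (lie_fun y z) + lie_fun y (lie_fun z x) + lie_fun z (lie_fun x y)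
      = 0
}.

Definition splitting (F : fieldType) (g : vectType F) (br : lie_bracket g)
    (l u : {vspace g}) : Prop :=
  [/\ (l + u)%VS = fullv, (l :&: u)%VS = 0%VS,
      {in l &, forall x y, br x y \in l} &
      {in l & u, forall x y, br x y \in u}].

(* el and eu are bases of l and u. The symmetric algebra of l is
   {mpoly F[p]}, with 'X_k standing for el`_k. Tensors are given by their
   coordinates in the basis el ++ eu of g: an element of g (x) g (x) A is a
   matrix over A, an element of g (x) g (x) g (x) A a family indexed by triples;
   here A = K is the fraction field of the power series in p variables. *)
Section Split.
Variables (F : fieldType) (g : vectType F) (br : lie_bracket g).
Variables (l u : {vspace g}) (p q : nat) (el : p.-tuple g) (eu : q.-tuple g).

Local Notation N := (p + q)%N.
Local Notation K := {fraction mfps F p}.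

Definition br_l (x y : g) : g := daddv_pi l u (br x y).

(* The dual of l is the annihilator of u in the dual of g. *)
Definition in_l_dual (lam : 'Hom(g, F^o)) : Prop := (u <= lker lam)%VS.

Definition omega (lam : 'Hom(g, F^o)) (x y : g) : F := lam (br_l x y).

(* P holds on a nonempty Zariski open subset of the dual of l. *)
Definition generic_l_dual (P : 'Hom(g, F^o) -> Prop) : Prop :=
  exists2 h : {mpoly F[p]}, h != 0 &
    forall lam, in_l_dual lam -> h.@[fun k => lam el`_k] != 0 -> P lam.

Definition nondegenerate_splitting : Prop :=
  generic_l_dual (fun lam =>
    forall x, x \in u -> (forall y, y \in u -> omega lam x y = 0) -> x = 0).

Definition sym_of (x : g) : {mpoly F[p]} := \sum_(k < p) coord el k x *: 'X_k.

Fact sym_of_linear : linear sym_of.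
Proof.
move=> a x y; rewrite /sym_of scaler_sumr -big_split /=.
by apply: eq_bigr => k _; rewrite linearP scalerDl scalerA.
Qed.

HB.instance Definition _ :=
  GRing.isLinear.Build F g {mpoly F[p]} _ sym_of sym_of_linear.

Definition omega_mx : 'M[{mpoly F[p]}]_q :=
  \matrix_(i, j) sym_of (br_l eu`_i eu`_j).

Definition D0 : {mpoly F[p]} := \det omega_mx.

Definition loc_of (h : {mpoly F[p]}) : K := tofrac (mfps_of h).

Fact loc_of_zmod : zmod_morphism loc_of.
Proof. by move=> x y; rewrite /loc_of !rmorphB. Qed.
Fact loc_of_monoid : monoid_morphism loc_of.
Proof. by split=> [|x y]; rewrite /loc_of ?rmorph1 ?rmorphM. Qed.
HB.instance Definition _ :=
  GRing.isZmodMorphism.Build {mpoly F[p]} K loc_of loc_of_zmod.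
HB.instance Definition _ :=
  GRing.isMonoidMorphism.Build {mpoly F[p]} K loc_of loc_of_monoid.

(* The subring S(l)[1/D_0] of K. *)
Definition in_sym_loc (x : K) : Prop :=
  exists (h : {mpoly F[p]}) (k : nat), x = loc_of h / loc_of D0 ^+ k.

(* w is the matrix, in the basis eu, of r = \sum_(i, j) w i j eu_i (x) eu_j;
   the third condition is the coefficient of eu_j in
   \sum_i [x, u_i]_l l_i (x) v_i = - 1 (x) x. *)
Definition is_r_matrix (w : 'M[K]_q) : Prop :=
  [/\ w^T = - w, (forall i j, in_sym_loc (w i j)) &
      forall x, x \in u -> forall j,
        \sum_(i < q) loc_of (sym_of (br_l x eu`_i)) * w i j
          = - loc_of (coord eu j x)%:MP].

Lemma r_matrix_unique_existence : basis_of u eu -> D0 != 0 ->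
  exists! w, is_r_matrix w.
Proof.
move=> bu D00; pose O := omega_mx.
pose OK : 'M[K]_q := map_mx loc_of O.
have brN x y : br x y = - br y x.
  apply/eqP; rewrite -addr_eq0; have := lie_alt br (x + y).
  have := lie_linearl br (x + y) 1 x y; rewrite !scale1r => ->.
  have := lie_linearr br x 1 x y; have := lie_linearr br y 1 x y.
  by rewrite !scale1r => -> ->; rewrite !lie_alt addr0 add0r => ->.
have ON : O^T = - O.
  by apply/matrixP => i j; rewrite !mxE /br_l brN !linearN.
have dOK : \det OK = loc_of D0 by rewrite det_map_mx.
have dOK0 : \det OK != 0.
  rewrite dOK /loc_of tofrac_eq0; apply: contra D00.
  by rewrite -(rmorph0 (@mfps_of F p)) (inj_eq (@mfps_of_inj _ _)).
have uOK : OK \in unitmx by rewrite unitmxE unitfE.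
have specE w : is_r_matrix w -> w = - invmx OK.
  case=> _ _ E; apply: (can_inj (mulKmx uOK)); rewrite mulmxN mulmxV //.
  apply/matrixP => i j; rewrite !mxE.
  have iu : eu`_i \in u by rewrite (basis_mem bu) // mem_nth // size_tuple.
  rewrite -[RHS]/(- (i == j)%:R).
  transitivity (- loc_of (coord eu j eu`_i)%:MP : K).
    rewrite -E //; apply: eq_bigr => k _; by rewrite !mxE.
  by rewrite coord_free ?(basis_free bu) // eq_sym; case: eqP; rewrite ?rmorph1 ?rmorph0.
exists (- invmx OK); split; last by move=> w /specE ->.
split.
- have OKT : OK^T = - OK by rewrite /OK matrix.map_trmx ON map_mxN.
  have E : (invmx OK)^T = - invmx OK.
    apply: (can_inj (mulmxK uOK)); rewrite mulNmx mulVmx //.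
    by rewrite -[X in _ *m X]opprK -OKT mulmxN -trmx_mul mulmxV // trmx1.
  move: E; move: (invmx OK) => X /matrixP E; apply/matrixP => i j.
  by have := E i j; rewrite !mxE => ->.
- move=> i j; exists (- (\adj O) i j), 1%N.
  have EA : invmx OK = (\det OK)^-1 *: map_mx loc_of (\adj O).
    by rewrite /invmx uOK map_mx_adj.
  rewrite expr1 -dOK EA; move: (\adj O) => A.
  by rewrite !mxE rmorphN mulNr mulrC.
move=> x xu j.
have Ex := coord_basis bu xu.
have Ei (i : 'I_q) : \sum_(k < q) loc_of (sym_of (br_l eu`_i eu`_k))
    * (- invmx OK) k j = - (i == j)%:R.
  have /matrixP/(_ i j) := mulmxV uOK; rewrite !mxE => <-.
  rewrite -sumrN; apply: eq_bigr => k _; rewrite !mxE.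
  by rewrite -mulrN; congr (_ * _); rewrite mxE.
have Es k : sym_of (br_l x eu`_k)
    = \sum_(i < q) (coord eu i x)%:MP * sym_of (br_l eu`_i eu`_k).
  pose h z := sym_of (br_l z eu`_k).
  have hP c y z : h (c *: y + z) = c *: h y + h z.
    by rewrite /h /br_l (lie_linearl br) !linearP.
  have hD : {morph h : y z / y + z} by move=> y z; rewrite -[y]scale1r hP !scale1r.
  have h0 : h 0 = 0 by apply: (addrI (h 0)); rewrite -hD !addr0.
  rewrite -/(h x) {1}Ex (big_morph h hD h0); apply: eq_bigr => i _.
  by rewrite -[_ *: _]addr0 hP h0 addr0 mul_mpolyC.
under eq_bigr do rewrite Es rmorph_sum mulr_suml.
rewrite exchange_big /=.
transitivity (\sum_(i < q) loc_of (coord eu i x)%:MP * - (i == j)%:R : K).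
  apply: eq_bigr => i _; rewrite -Ei mulr_sumr.
  by apply: eq_bigr => k _; rewrite rmorphM mulrA.
rewrite (bigD1 j) //= big1 ?addr0 ?eqxx ?mulrN1 // => i /negPf ->.
by rewrite oppr0 mulr0.
Qed.
Definition basis_g : N.-tuple g := [tuple of el ++ eu].
Local Notation e := basis_g.

Definition struct_cst (a b k : 'I_N) : F := coord e k (br e`_a e`_b).

Definition ad_mx (x : g) : 'M[F]_N := \matrix_(k, i) coord e k (br x e`_i).

Definition sym_invariant (t : 'M[F]_N) : Prop :=
  t^T = t /\ forall x : g, ad_mx x *m t + t *m (ad_mx x)^T = 0.

Definition tens3 := {ffun 'I_N * 'I_N * 'I_N -> K^o}.

Local Notation sc a b k := (loc_of (struct_cst a b k)%:MP).

(* [r^{1,2}, s^{1,3}], [r^{1,2}, s^{2,3}] and [r^{1,3}, s^{2,3}] *)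
Definition br1213 (r s : 'M[K]_N) : tens3 := [ffun x => let: (i, j, k) := x in
  \sum_a \sum_b sc a b i * r a j * s b k].
Definition br1223 (r s : 'M[K]_N) : tens3 := [ffun x => let: (i, j, k) := x in
  \sum_a \sum_b sc a b j * r i a * s b k].
Definition br1323 (r s : 'M[K]_N) : tens3 := [ffun x => let: (i, j, k) := x in
  \sum_a \sum_b sc a b k * r i a * s j b].

Definition CYB (r : 'M[K]_N) : tens3 := br1213 r r + br1223 r r + br1323 r r.

(* The third tensor factor of d lies in l: the component along el_h is the
   partial derivative with respect to 'X_h, that along eu_h is zero. *)
Definition dtens (r : 'M[K]_N) : tens3 := [ffun x => let: (i, j, k) := x in
  if split k is inl h then frac_deriv h (r i j) else 0].

Definition Alt (T : tens3) : tens3 := [ffun x => let: (i, j, k) := x in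
  T (i, j, k) + T (j, k, i) + T (k, i, j)].

(* Coordinates, in the basis dual to e, of the generic point of the dual of l. *)
Definition lam_gen (a : 'I_N) : {mpoly F[p]} :=
  if split a is inl h then 'X_h else 0.

(* (lam (x) id)(t) *)
Definition lam_vee (t : 'M[F]_N) (b : 'I_N) : {mpoly F[p]} :=
  \sum_a t a b *: lam_gen a.

Definition ad_lam_vee (t : 'M[F]_N) : 'M[{mpoly F[p]}]_N :=
  \matrix_(k, i) \sum_b struct_cst b i k *: lam_vee t b.

(* The power series \sum_k a_k A^k for A with linear forms as entries: A^k is
   homogeneous of degree k, so that only k = mdeg m contributes to the
   coefficient of the monomial m. *)
Definition fps_app (a : nat -> F) (A : 'M[{mpoly F[p]}]_N) : 'M[mfps F p]_N :=
  \matrix_(i, j) MFPS (fun m => \sum_(k < (mdeg m).+1) a k * ((A ^+ k) i j)@_m).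

Definition cst_mx (t : 'M[F]_N) : 'M[K]_N := map_mx (fun x => loc_of x%:MP) t.

Definition rho (f : nat -> F) (t : 'M[F]_N) (w : 'M[K]_q) (c : F) : 'M[K]_N :=
  block_mx 0 0 0 w
  + loc_of c%:MP *:
      (map_mx tofrac (fps_app f (c%:MP *: ad_lam_vee t)) *m cst_mx t).

Definition Ztens (t : 'M[F]_N) : tens3 := br1223 (cst_mx t) (cst_mx t).

End Split.

Section Cotangent.
Variable R : realType.
Local Notation C := R[i].
Definition piC : C := (trigo.pi : R)%:C%C.

(* The univariate power series with coefficients a. *)
Definition ups (a : nat -> C) : mfps C 1 := MFPS (fun m => a (mdeg m)).
(* Taylor series of sin (pi x) and cos (pi x). *)
Definition sin_pi_series : mfps C 1 :=
  ups (fun k => (trigo.sin_coeff (trigo.pi : R) k)%:C%C).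
Definition cos_pi_series : mfps C 1 :=
  ups (fun k => (trigo.cos_coeff (trigo.pi : R) k)%:C%C).

(* - 1/x + pi cot (pi x) in the field of formal Laurent series. *)
Definition f_laurent : {fraction mfps C 1} :=
  - (tofrac (mfps_of 'X_ord0))^-1
  + tofrac (mfps_of piC%:MP) * (tofrac cos_pi_series / tofrac sin_pi_series).


Lemma mnm1E (m : 'X_{1..1}) : m = (U_(ord0) *+ mdeg m)%MM.
Proof.
by apply/mnmP => i; rewrite mulmnE mnm1E (ord1 i) eqxx mul1n mdegE big_ord1.
Qed.

Lemma ups_shift (a : nat -> C) : a 0%N = 0 ->
  ups a = mfps_of 'X_ord0 * ups (fun k => a k.+1).
Proof.
move=> a0; apply/mfpsP => m; pose d := mdeg m; rewrite mulrC.
rewrite (@mfps_coefM _ _ d) //.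
rewrite (@mcoeffM_loc _ _ _ _ (mfps_trunc d (ups (fun k => a k.+1))) 'X_ord0) //;
  last by move=> k le; rewrite mfps_truncE.
have := mnm1E m; rewrite -/d; move: d => [|d] em.
  rewrite em mulm0n /= mdeg0 a0 mcoeffM big1 // => -[k1 k2] /= /eqP.
  move/esym/eqP; rewrite mnmD_eq0 => /andP[_ /eqP ->].
  by rewrite mcoeffX -mdeg_eq0 mdeg1 mulr0.
rewrite em mulmS mcoeffMX mfps_truncE ?mdegMn ?mdeg1 ?mul1n //=.
by rewrite !mdegD !mdegMn mdeg1 !mul1n.
Qed.

Fact f_laurent_regular : exists h : mfps C 1, tofrac h = f_laurent.
Proof.
pose sn k : C := (trigo.sin_coeff (trigo.pi : R) k)%:C%C.
pose cs k : C := (trigo.cos_coeff (trigo.pi : R) k)%:C%C.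
pose S := ups (fun k => sn k.+1).
pose N := ups (fun k => piC * cs k.+1 - sn k.+2).
have s0 : sn 0%N = 0 by rewrite /sn /trigo.sin_coeff /= !mul0r.
have s1 : sn 1%N = piC by rewrite /sn /trigo.sin_coeff /= !mul1r divr1.
have c0 : cs 0%N = 1.
  rewrite /cs /trigo.cos_coeff /= !mul1r. by rewrite fact0 invr1.
have pi0 : piC != 0.
  by rewrite /piC eq_complex /= eqxx andbT gt_eqF // trigo.pi_gt0.
have US : S \is a GRing.unit by apply: mfps_unitP; rewrite /= mdeg0 s1.
have EX : sin_pi_series = mfps_of 'X_ord0 * S by apply: ups_shift.
have EN : mfps_of piC%:MP * cos_pi_series - S = mfps_of 'X_ord0 * N.
  rewrite -(@ups_shift (fun k => piC * cs k - sn k.+1)) ?c0 ?s1 ?mulr1 ?subrr //.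
  apply/mfpsP => m; rewrite mfps_coefB (@mfps_coefM _ _ (mdeg m)) //.
  rewrite (@mcoeffM_loc _ _ _ _ piC%:MP (mfps_trunc (mdeg m) cos_pi_series)) //;
    last by move=> k le; rewrite mfps_truncE.
  by rewrite mcoeffCM mfps_truncE.
have X0 : tofrac (mfps_of 'X_ord0 : mfps C 1) != 0.
  rewrite tofrac_eq0 -(rmorph0 (@mfps_of C 1)) (inj_eq (@mfps_of_inj _ _)).
  by rewrite -msupp_eq0 msuppX.
have S0 : tofrac S != 0 by rewrite tofrac_eq0; apply: contraTneq US => ->; rewrite unitr0.
exists (N * S^-1); rewrite /f_laurent EX !tofracM.
have -> : tofrac S^-1 = (tofrac S)^-1.
  by apply: (mulIf S0); rewrite -tofracM mulVr // mulVf // tofrac1.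
have := congr1 (@FracField.tofrac _) EN; rewrite tofracB !tofracM => EN'.
have field_id (L : fieldType) (n s x y : L) :
    x != 0 -> s != 0 -> y - s = x * n -> n / s = - x^-1 + y / (x * s).
  move=> x0 s0'; move/eqP; rewrite subr_eq => /eqP ->.
  by field; rewrite x0 s0'.
by rewrite (field_id _ _ _ _ _ X0 S0 EN') mulrA.
Qed.

(* f is regular at 0: f_series is its Taylor series there. *)
Definition f_series : mfps C 1 := projT1 (cid f_laurent_regular).

Lemma f_seriesE : tofrac f_series = f_laurent.
Proof. exact: projT2 (cid f_laurent_regular). Qed.

Definition f_coef (k : nat) : C := f_series (U_(ord0) *+ k)%MM.
End Cotangent.

(* Main.v *)
(* Write rho = r + phi with phi = c f(c ad lam^vee) t, and split the left-hand
   side into three parts, each of which is computed separately.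
   (1) CYB(r) + Alt(dr) = 0: dr = r (d omega) r cancels the components of CYB(r)
   with a factor in l, and the component in u (x) u (x) u vanishes because
   lam ([.,.]) is a closed form (Jacobi), contracted three times with r.
   (2) For x in u, ad^*_x lam lies in the annihilator of l and, omega being
   invertible, these directions span it. As phi is the restriction to the dual
   of l of an equivariant function on the dual of g, the cross terms of CYB(rho)
   equal the part of Alt(d phi) missing from d, namely the derivatives in the
   directions dual to u.
   (3) There remains the identity CYB(phi) + Alt(d phi) = - pi^2 c^2 Z with the
   full differential d over the dual of g. By invariance of t both terms are
   power series in the operators ad lam^vee acting on the three factors of Z;
   these operators commute and their sum kills Z. The identity then becomes
   cot x cot y + cot y cot z + cot z cot x = 1 for x + y + z = 0, which follows
   from cot' = - 1 - cot^2 alone. *)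
Require Import Defs.
From mathcomp Require Import all_boot all_order all_algebra.
From mathcomp Require Import boolp reals complex mpoly.
From mathcomp Require Import ring.
From mathcomp Require trigo.

Set Implicit Arguments.
Unset Strict Implicit.
Unset Printing Implicit Defensive.

Import Order.TTheory GRing.Theory Num.Theory.
Local Open Scope ring_scope.

(** * Power series by homogeneous components *)

Section GradedSeries.
Variables (F : fieldType) (n : nat).
Implicit Types (P Q : nat -> {mpoly F[n]}) (m : 'X_{1..n}).

Lemma mcoeff_bigsum I (r : seq I) (A : pred I) (G : I -> {mpoly F[n]}) m :
  (\sum_(i <- r | A i) G i)@_m = \sum_(i <- r | A i) (G i)@_m.
Proof. exact: raddf_sum. Qed.

(** The formal sum of the [P d] when each [P d] is homogeneous of degree [d]. An identity between
    such series reduces to one polynomial identity in each degree. *)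
Definition ser P : mfps F n := MFPS (fun m => (P (mdeg m))@_m).

Lemma serE P m : ser P m = (P (mdeg m))@_m. Proof. by []. Qed.

Lemma eq_ser P Q : P =1 Q -> ser P = ser Q.
Proof. by move=> PQ; apply/mfpsP => m; rewrite !serE PQ. Qed.

Lemma serD P Q : ser P + ser Q = ser (fun d => P d + Q d).
Proof. by apply/mfpsP => m; rewrite mfps_coefD !serE mcoeffD. Qed.

Lemma serN P : - ser P = ser (fun d => - P d).
Proof. by apply/mfpsP => m; rewrite mfps_coefN !serE mcoeffN. Qed.

Lemma ser_sum I (r : seq I) (A : pred I) (G : I -> nat -> {mpoly F[n]}) :
  \sum_(i <- r | A i) ser (G i) = ser (fun d => \sum_(i <- r | A i) G i d).
Proof. by apply/mfpsP => m; rewrite mfps_coef_sum serE mcoeff_bigsum. Qed.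

(** For a decomposition [m = k1 + k2], homogeneity leaves only the index [i = mdeg k1]. *)
Lemma serM P Q : (forall d, P d \is d.-homog) -> (forall d, Q d \is d.-homog) ->
  ser P * ser Q = ser (fun d => \sum_(i < d.+1) P i * Q (d - i)%N).
Proof.
move=> hP hQ; apply/mfpsP => m; rewrite serE mcoeff_bigsum.
under eq_bigr do rewrite mcoeffM; rewrite exchange_big /=.
apply: eq_bigr => -[[k1 ?] [k2 ?]] /= /eqP em.
have dm : mdeg m = (mdeg k1 + mdeg k2)%N by rewrite -mdegD -em.
have lt1 : (mdeg k1 < (mdeg m).+1)%N by rewrite ltnS dm leq_addr.
rewrite (bigD1 (Ordinal lt1)) //= big1 ?addr0 => [|i ne].
  by rewrite dm addKn.
rewrite (dhomog_nemf_coeff (hP i)) ?mul0r //.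
by apply: contra ne => /eqP e; apply/eqP/val_inj; rewrite /= -e.
Qed.

Lemma ser_constM c P : mfps_of c%:MP * ser P = ser (fun d => c *: P d).
Proof.
apply/mfpsP => m; rewrite serE (@mfps_coefM _ _ (mdeg m)) //.
rewrite (@mcoeffM_loc _ _ _ _ c%:MP (mfps_trunc (mdeg m) (ser P))) //; last first.
  by move=> k le; rewrite mfps_truncE.
by rewrite mcoeffCM mcoeffZ mfps_truncE.
Qed.

Lemma mfps_of_ser d (h : {mpoly F[n]}) : h \is d.-homog ->
  mfps_of h = ser (fun k => if k == d then h else 0).
Proof.
move=> hh; apply/mfpsP => m; rewrite serE /=; case: eqP => // /eqP ne.
by rewrite mcoeff0 (dhomog_nemf_coeff hh).
Qed.

Lemma ser_homogM d (h : {mpoly F[n]}) P :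
  h \is d.-homog -> (forall k, P k \is k.-homog) ->
  mfps_of h * ser P = ser (fun k => if (d <= k)%N then h * P (k - d)%N else 0).
Proof.
move=> hh hP; rewrite (mfps_of_ser hh) serM //; last first.
  by move=> k; case: eqP => [->|_]; rewrite ?dhomog0.
apply: eq_ser => k; case: ifP => [le|gt].
  have lt : (d < k.+1)%N by [].
  rewrite (bigD1 (Ordinal lt)) //= eqxx big1 ?addr0 // => i ne.
  by case: eqP => e; rewrite ?mul0r //; case/eqP: ne; apply/val_inj.
rewrite big1 // => i _; case: eqP => e; rewrite ?mul0r //.
by move: (ltn_ord i); rewrite e ltnS gt.
Qed.

Lemma deriv_ser h P : mfps_deriv h (ser P) = ser (fun d => (P d.+1)^`M(h)).
Proof.
by apply/mfpsP => m; rewrite !serE mcoeff_deriv /= mdegD mdeg1 addn1.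
Qed.

End GradedSeries.

(** * Power series in one variable, the Euler operator and dilations *)

Section OneVariable.
Variable F : fieldType.
Implicit Types p q : mfps F 1.

Definition scoef p d : F := p (U_(ord0) *+ d)%MM.

Lemma mdegU1 d : mdeg (U_(@ord0 0) *+ d)%MM = d.
Proof. by rewrite mdegMn mdeg1 mul1n. Qed.

Lemma scoefP p q : scoef p =1 scoef q -> p = q.
Proof. by move=> H; apply/mfpsP => m; rewrite (Defs.mnm1E m); exact: H. Qed.

Lemma ser1E p : p = ser (fun d => scoef p d *: 'X_ord0 ^+ d).
Proof.
apply: scoefP => d; rewrite /scoef serE mdegU1 mcoeffZ mpolyXn mcoeffX eqxx.
by rewrite mulr1.
Qed.

Lemma scoefD p q d : scoef (p + q) d = scoef p d + scoef q d.
Proof. by []. Qed.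

Lemma scoefN p d : scoef (- p) d = - scoef p d.
Proof. by []. Qed.

Lemma scoefM p q d :
  scoef (p * q) d = \sum_(i < d.+1) scoef p i * scoef q (d - i)%N.
Proof.
rewrite {1}(ser1E p) {1}(ser1E q) serM; last first.
- by move=> k; rewrite dhomogZ // mpolyXn dhomogX /= mdegU1.
- by move=> k; rewrite dhomogZ // mpolyXn dhomogX /= mdegU1.
rewrite /scoef serE mcoeff_bigsum mdegU1; apply: eq_bigr => i _.
rewrite -scalerAl -scalerAr -exprD subnKC ?leq_ord //.
by rewrite !mcoeffZ mpolyXn mcoeffX eqxx mulr1.
Qed.

Definition const1 c : mfps F 1 := mfps_of c%:MP.

Lemma scoefC c d : scoef (const1 c) d = if d == 0%N then c else 0.
Proof.
rewrite /scoef /= mcoeffC -mdeg_eq0 mdegU1.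
by case: eqP; rewrite ?mulr1 ?mulr0.
Qed.

Lemma scoefCM c p d : scoef (const1 c * p) d = c * scoef p d.
Proof.
rewrite scoefM big_ord_recl scoefC eqxx subn0 big1 ?addr0 // => i _.
by rewrite scoefC mul0r.
Qed.

Definition X1 : mfps F 1 := mfps_of 'X_ord0.

Lemma scoefX d : scoef X1 d = (d == 1%N)%:R.
Proof.
rewrite /scoef /= mcoeffX; congr (nat_of_bool _)%:R; apply/eqP/eqP => [e|->].
  by have := congr1 (@mdeg _) e; rewrite mdeg1 mdegU1.
by rewrite mulm1n.
Qed.

Lemma scoefXM p d : scoef (X1 * p) d = if d is k.+1 then scoef p k else 0.
Proof.
rewrite scoefM; case: d => [|k].
  by rewrite big_ord1 scoefX mul0r.
rewrite big_ord_recl big_ord_recl big1 => [|i _].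
  by rewrite !scoefX /= mul0r add0r mul1r addr0 /= subn1.
by rewrite scoefX /= mul0r.
Qed.

Lemma X1_neq0 : X1 != 0.
Proof.
apply/eqP => /(congr1 (fun s => scoef s 1)); rewrite scoefX => /eqP.
by rewrite oner_eq0.
Qed.

(** The operator [x d/dx]. It preserves degrees and commutes with dilations, so that an equation for
    one series passes to all its dilates. *)
Definition euler p := X1 * mfps_deriv ord0 p.

Lemma scoef_deriv p d : scoef (mfps_deriv ord0 p) d = scoef p d.+1 *+ d.+1.
Proof.
rewrite /scoef /=; congr (p _ *+ _); first by rewrite mulmSr.
by rewrite mulmnE mnm1E eqxx mul1n.
Qed.

Lemma scoef_euler p d : scoef (euler p) d = scoef p d *+ d.
Proof. by rewrite /euler scoefXM; case: d => // d; rewrite scoef_deriv. Qed.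

Lemma eulerM p q : euler (p * q) = euler p * q + p * euler q.
Proof. by rewrite /euler mfps_derivM; ring. Qed.

Lemma eulerD p q : euler (p + q) = euler p + euler q.
Proof. by apply: scoefP => d; rewrite scoefD !scoef_euler scoefD mulrnDl. Qed.

Lemma eulerN p : euler (- p) = - euler p.
Proof. by apply: scoefP => d; rewrite scoefN !scoef_euler scoefN mulNrn. Qed.

Lemma euler_const c : euler (const1 c) = 0.
Proof.
apply: scoefP => d; rewrite scoef_euler scoefC; case: d => // d.
by rewrite mul0rn.
Qed.

Lemma eulerX : euler X1 = X1.
Proof.
apply: scoefP => d; rewrite scoef_euler scoefX.
by case: d => [|[|d]] //=; rewrite mul0rn.
Qed.

Definition dilate x p : mfps F 1 := MFPS (fun m => p m * x ^+ mdeg m).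

Lemma scoef_dilate x p d : scoef (dilate x p) d = scoef p d * x ^+ d.
Proof. by rewrite /scoef /= mdegU1. Qed.

Lemma dilateM x p q : dilate x (p * q) = dilate x p * dilate x q.
Proof.
apply: scoefP => d; rewrite scoef_dilate !scoefM mulr_suml.
apply: eq_bigr => i _; rewrite !scoef_dilate mulrACA -exprD subnKC //.
exact: leq_ord.
Qed.

Lemma dilateD x p q : dilate x (p + q) = dilate x p + dilate x q.
Proof.
by apply: scoefP => d; rewrite !(scoef_dilate, scoefD) mulrDl.
Qed.

Lemma dilateN x p : dilate x (- p) = - dilate x p.
Proof.
by apply: scoefP => d; rewrite !(scoef_dilate, scoefN) mulNr.
Qed.

Lemma dilateC x c : dilate x (const1 c) = const1 c.
Proof.
apply: scoefP => -[|d]; rewrite scoef_dilate scoefC ?mulr1 // ?mul0r //.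
Qed.

Lemma dilateX x : dilate x X1 = const1 x * X1.
Proof.
apply: scoefP => d; rewrite scoef_dilate scoefCM scoefX.
by case: d => [|[|d]]; rewrite /= ?mul1r ?mul0r ?mulr0 ?expr1 ?mulr1.
Qed.

Lemma euler_dilate x p : euler (dilate x p) = dilate x (euler p).
Proof.
by apply: scoefP => d; rewrite !(scoef_euler, scoef_dilate) mulrnAl.
Qed.

End OneVariable.

Lemma tofrac_neq0 (D : idomainType) (x : D) : x != 0 -> tofrac x != 0.
Proof. by rewrite tofrac_eq0. Qed.

(** * The cotangent series *)

Section CotangentEquation.
Variable F : numFieldType.
Implicit Types (G p q h : mfps F 1) (x k : F).

(* Satisfied by [G = x g] as soon as [g' = - k - g^2]. *)
Definition cot_equation k G : Prop :=
  euler G = G - const1 k * X1 F ^+ 2 - G ^+ 2.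

(** In degree [d] the equation reads [(d + 1) q_d = - sum_(i >= 1) h_i q_(d - i)], and [d + 1] is
    invertible in characteristic 0. Induction kills every coefficient, including [q_0]. *)
Lemma euler_linear_eq0 q h : scoef h 0 = 0 -> euler q = - (1 + h) * q -> q = 0.
Proof.
move=> h0 Eq; apply: scoefP; elim/ltn_ind => d IHd.
have := congr1 (fun s => scoef s d) Eq; rewrite scoef_euler mulNr mulrDl mul1r.
rewrite scoefN scoefD scoefM big_ord_recl h0 mul0r add0r.
rewrite big1 => [|i _]; last first.
  rewrite /= /bump leq0n add1n IHd ?mulr0 //.
  by rewrite subnS prednK ?subn_gt0 ?leq_subr.
rewrite addr0 -[scoef 0 d]/(0 : F) => /eqP.
rewrite -addr_eq0 -mulrSr mulrn_eq0 /= => /eqP //.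
Qed.

(* The difference [q] of both sides satisfies
   [euler q = (2 - Gx - Gy - Gz) q], whence [q = 0]; no initial condition on
   [q] is needed. Dividing by [x y z X1^2] gives the addition formula of the
   cotangent. *)
Lemma cot_addition k G x y z : cot_equation k G -> scoef G 0 = 1 ->
  x + y + z = 0 ->
  let Gx := dilate x G in let Gy := dilate y G in let Gz := dilate z G in
  const1 z * Gx * Gy + const1 x * Gy * Gz + const1 y * Gz * Gx
  = const1 (k * x * y * z) * X1 F ^+ 2.
Proof.
move=> EG G0 xyz Gx Gy Gz.
have E v : euler (dilate v G) =
    dilate v G - const1 (k * v ^+ 2) * X1 F ^+ 2 - dilate v G ^+ 2.
  rewrite euler_dilate EG !dilateD !dilateN expr2 dilateM dilateC expr2 !dilateM.
  rewrite dilateX /const1 !rmorphM /=; ring.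
apply/eqP; rewrite -subr_eq0; apply/eqP.
(* Here [1 + h = Gx + Gy + Gz - 2], and [h] has constant term [3 - 3 = 0] because that of [G] is
   1. *)
apply: (@euler_linear_eq0 _ (Gx + Gy + Gz - 3%:R)).
  rewrite !scoefD !scoef_dilate G0 !mulr1 scoefN.
  have -> : scoef (3%:R : mfps F 1) 0 = 3%:R.
    rewrite -[3%:R](rmorph_nat (@mfps_of F 1)) -mpolyC_nat.
    by rewrite -/(const1 _) scoefC.
  by ring.
rewrite !(eulerD, eulerN, eulerM, euler_const, eulerX, E, expr2).
rewrite -/Gx -/Gy -/Gz.
have -> : z = - (x + y) by apply/eqP; rewrite -addr_eq0 addrC xyz.
rewrite /const1 !(rmorphM, rmorphN, rmorphD) /=; ring.
Qed.

End CotangentEquation.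

(** * The series of sine and cosine, and the differential equation of [f] *)

Section CotangentSeries.
Variable R : realType.
Local Notation C := R[i].
Local Notation S := (sin_pi_series R).
Local Notation T := (cos_pi_series R).

Lemma scoef_ups (a : nat -> C) d : scoef (ups a) d = a d.
Proof. by rewrite /scoef /= mdegU1. Qed.

Lemma euler_sin : euler S = const1 (piC R) * (X1 C * T).
Proof.
apply: scoefP => -[|d]; rewrite scoef_euler scoefCM scoefXM !scoef_ups //.
  by rewrite mulr0.
rewrite /trigo.sin_coeff /trigo.cos_coeff /piC /= -rmorphMn -rmorphM /=.
congr (_%:C)%C; rewrite -?exprnP exprS factS natrM -mulr_natr.
have d0 : (d.+1%:R : R) != 0 by rewrite pnatr_eq0.
have f0 : (d`!%:R : R) != 0 by rewrite pnatr_eq0 -lt0n fact_gt0.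
by move: d.+1%:R d`!%:R d0 f0 => y v d0 f0; field; rewrite d0 f0.
Qed.

Lemma euler_cos : euler T = - (const1 (piC R) * (X1 C * S)).
Proof.
apply: scoefP => -[|d]; rewrite scoef_euler scoefN scoefCM scoefXM !scoef_ups //.
  by rewrite mulr0 oppr0.
rewrite /trigo.sin_coeff /trigo.cos_coeff /piC /= -rmorphMn -rmorphM -rmorphN /=.
congr (_%:C)%C; rewrite -?exprnP exprS factS natrM -mulr_natr negbK.
have d0 : (d.+1%:R : R) != 0 by rewrite pnatr_eq0.
have f0 : (d`!%:R : R) != 0 by rewrite pnatr_eq0 -lt0n fact_gt0.
case: (boolP (odd d)) => od; last by rewrite /= !(mul0r, mulr0, oppr0).
have -> : uphalf d = d.-1./2.+1.
  by case: d od {d0 f0} => // d /= od.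
rewrite exprS; move: d.+1%:R d`!%:R d0 f0 => y v d0 f0.
by field; rewrite d0 f0.
Qed.

Lemma sin_neq0 : S != 0.
Proof.
apply/eqP => /(congr1 (fun s => scoef s 1)); rewrite scoef_ups.
rewrite /trigo.sin_coeff /= !mul1r divr1 => /eqP.
by rewrite eq_complex /= eqxx andbT gt_eqF // trigo.pi_gt0.
Qed.

(** The series [1 + X f] is [pi X cot (pi X)]. Multiplying by the sine keeps the relation inside the
    ring of power series. *)
Lemma cot_series : (1 + X1 C * f_series R) * S = const1 (piC R) * (X1 C * T).
Proof.
have := f_seriesE R; rewrite /f_laurent; move: (f_series R) => f.
have := tofrac_neq0 (X1_neq0 C); have := tofrac_neq0 sin_neq0.
rewrite -[mfps_of 'X_ord0]/(X1 C) -[mfps_of _%:MP]/(const1 (piC R)).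
move: (X1 C) (const1 _) S T => x k s c s0 x0 E.
apply/eqP; rewrite -tofrac_eq !(tofracM, tofracD) tofrac1 E; apply/eqP.
have cancel_cot (L : fieldType) (x' k' s' c' : L) : x' != 0 -> s' != 0 ->
    (1 + x' * (- x'^-1 + k' * (c' / s'))) * s' = k' * (x' * c').
  by move=> x0' s0'; field; rewrite s0' x0'.
exact: cancel_cot.
Qed.

(** For [g = pi cot (pi x)] this is [g' = - pi^2 - g^2]. It results from applying [euler] to
    [cot_series] and cancelling the sine. *)
Lemma f_cot_equation : cot_equation (piC R ^+ 2) (1 + X1 C * f_series R).
Proof.
rewrite /cot_equation; set G := _ + _; apply: (mulIf sin_neq0).
have := congr1 (@euler _) cot_series; rewrite -/G !eulerM euler_const eulerX.
rewrite euler_sin euler_cos => E.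
have -> : euler G * S =
    const1 (piC R) * (X1 C * T + X1 C * - (const1 (piC R) * (X1 C * S)))
    - G * (const1 (piC R) * (X1 C * T)).
  by apply/eqP; rewrite eq_sym subr_eq E mul0r add0r.
have CS : G * S = const1 (piC R) * (X1 C * T) := cot_series.
rewrite mulrDr -!CS /const1 !rmorphXn /=.
by move: G S (mfps_of _%:MP) (X1 C) {E CS} => G s k x; ring.
Qed.

End CotangentSeries.

(** * The cotangent identity in each degree *)

Section CotangentIdentity.
Variables (F : numFieldType) (k : F) (f : mfps F 1).
Hypothesis f_ode : cot_equation k (1 + X1 F * f).
Local Notation a := (scoef f).

(** Dividing the equation of [1 + X f] by [X] gives [euler f + 2 f + k X + X f^2 = 0], whose
    coefficient of degree [d] is taken. *)
Lemma cot_coef_rec d : a d *+ d.+2 =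
  - (k *+ (d == 1%N)) - \sum_(i < d) a i * a (d.-1 - i)%N.
Proof.
have E : euler f + f + f + const1 k * X1 F + X1 F * (f * f) = 0.
  move: f_ode; rewrite /cot_equation eulerD eulerM eulerX.
  have -> : euler (1 : mfps F 1) = 0.
    by rewrite -[1](rmorph1 (@mfps_of F 1)) -mpolyC1 -/(const1 1) euler_const.
  move=> E; apply: (mulfI (X1_neq0 F)); rewrite mulr0.
  move: E => /eqP; rewrite -subr_eq0 => /eqP E; rewrite -[RHS]E.
  move: (X1 F) (const1 k) (euler f) {E}.
  by move: f => h x c e; ring.
have := congr1 (fun s => scoef s d) E.
rewrite !scoefD scoefXM scoefCM scoefX => {}E.
apply/eqP; rewrite -subr_eq0 opprD !opprK -[X in _ == X](E : _ = 0).
rewrite scoef_euler !mulrSr !addrA -[k *+ _]mulr_natr; apply/eqP; congr (_ + _).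
case: d {E} => [|d]; first by rewrite big_ord0.
by rewrite scoefM; apply: eq_bigr.
Qed.

(** For even [d] the indices [i] and [d - 1 - i] in the recursion have odd sum, so one of them is
    even and smaller than [d]. Hence [f] is odd. *)
Lemma cot_coef_even d : ~~ odd d -> a d = 0.
Proof.
elim/ltn_ind: d => d IHd od; apply/eqP; have := cot_coef_rec d.
have -> : (d == 1%N) = false by case: eqP od => // ->.
rewrite mulr0n oppr0 add0r big1 => [|i _].
  by move/eqP; rewrite oppr0 mulrn_eq0.
have [oi|/negPf ei] := boolP (odd i); last by rewrite IHd ?ei ?mul0r.
rewrite [a (_ - _)%N]IHd ?mulr0 //.
  by case: (d) i {oi} => [[]//|e] i; rewrite /= ltnS leq_subr.
have := ltn_ord i; case: (d) od i oi => // e /= oe i oi lt.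
by rewrite oddB; [rewrite oi; case: (odd e) oe | rewrite -ltnS].
Qed.

(** The coefficient of [x^i y^(d - i)]: the first term comes from the bracket of the cotangent
    tensor with itself, the second from its derivative. *)
Definition cot_weight d i : F := a i * a (d - i)%N - (-1) ^+ (d - i)%N * a d.+1.

(** As [d + 1] is odd, this factors [x^(d + 1) - (- y)^(d + 1)]. *)
Lemma alt_power_sum (x y : F) d : ~~ odd d ->
  (x + y) * (\sum_(i < d.+1) (-1) ^+ (d - i)%N * (x ^+ i * y ^+ (d - i)%N))
  = x ^+ d.+1 + y ^+ d.+1.
Proof.
move=> od; have := subrXX x (- y) d.+1; rewrite opprK exprNn.
rewrite -signr_odd /= od expr1 mulN1r opprK => ->; congr (_ * _).
rewrite (reindex_inj rev_ord_inj) /=; apply: eq_bigr => i _.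
rewrite subSS subKn ?leq_ord // [in RHS]exprNn mulrCA; congr (_ * _).
Qed.

(** In terms of [f] the addition formula equates [x y z X (f(x) f(y) + f(y) f(z) + f(z) f(x) - k)]
    with [x^2 f(x) + y^2 f(y) + z^2 f(z)]. Its coefficient of degree [d + 1], divided by [x y z], is
    the claim. *)
Lemma cot_weight_identity (x y z : F) d :
  x != 0 -> y != 0 -> z != 0 -> x + y + z = 0 ->
  \sum_(i < d.+1) cot_weight d i * (x ^+ i * y ^+ (d - i)%N
     + y ^+ i * z ^+ (d - i)%N + z ^+ i * x ^+ (d - i)%N) = k *+ (d == 0%N).
Proof.
move=> x0 y0 z0 xyz.
have G0 : scoef (1 + X1 F * f) 0 = 1.
  rewrite scoefD scoefXM addr0 -[1](rmorph1 (@mfps_of F 1)) -mpolyC1.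
  by rewrite -/(const1 1) scoefC.
have := cot_addition f_ode G0 xyz => /=.
rewrite !dilateD !dilateM !dilateX.
have d1 v : dilate v 1 = (1 : mfps F 1).
  by rewrite -[1](rmorph1 (@mfps_of F 1)) -mpolyC1 -/(const1 1) dilateC.
rewrite !d1; move: (dilate x f) (dilate y f) (dilate z f)
  (scoef_dilate x f) (scoef_dilate y f) (scoef_dilate z f) => fx fy fz Ex Ey Ez.
set X := X1 F => E.
have {}E : const1 (x * y * z) * (X * (fx * fy + fy * fz + fz * fx - const1 k))
    = const1 (x ^+ 2) * fx + const1 (y ^+ 2) * fy + const1 (z ^+ 2) * fz.
  apply: (mulfI (X1_neq0 F)); rewrite -/X; move/eqP: E.
  rewrite -subr_eq0 => /eqP E; apply/eqP; rewrite -subr_eq0 -[X in _ == X]E.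
  have -> : z = - (x + y) by apply/eqP; rewrite -addr_eq0 addrC xyz.
  rewrite /const1 !(rmorphXn, rmorphM, rmorphN, rmorphD) /=; apply/eqP.
  move: (mfps_of _%:MP) (mfps_of _%:MP) (mfps_of _%:MP) X {E Ex Ey Ez}.
  by move: fx fy fz => fx fy fz kk xx yy X; ring.
have := congr1 (fun s => scoef s d.+1) E.
rewrite scoefCM scoefXM !scoefD !scoefCM scoefN scoefC !scoefM Ex Ey Ez => {}E.
have xyz0 : x * y * z != 0 by rewrite !mulf_neq0.
apply: (mulfI xyz0).
pose P (u v : F) := \sum_(i < d.+1) a i * a (d - i)%N * (u ^+ i * v ^+ (d - i)%N).
pose N (u v : F) := \sum_(i < d.+1) (-1) ^+ (d - i)%N * (u ^+ i * v ^+ (d - i)%N).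
have EP u v (fu fv : mfps F 1) : (forall d, scoef fu d = a d * u ^+ d) ->
    (forall d, scoef fv d = a d * v ^+ d) ->
    \sum_(i < d.+1) scoef fu i * scoef fv (d - i)%N = P u v.
  by move=> Eu Ev; apply: eq_bigr => i _; rewrite Eu Ev mulrACA.
rewrite !(EP _ _ _ _ Ex Ey, EP _ _ _ _ Ey Ez, EP _ _ _ _ Ez Ex) in E.
have -> : \sum_(i < d.+1) cot_weight d i * (x ^+ i * y ^+ (d - i)%N
     + y ^+ i * z ^+ (d - i)%N + z ^+ i * x ^+ (d - i)%N)
   = P x y + P y z + P z x - a d.+1 * (N x y + N y z + N z x).
  rewrite /P /N -!big_split mulr_sumr -sumrB /=; apply: eq_bigr => i _.
  by rewrite /cot_weight; ring.
(* For even [d], the relation [z = - (x + y)] turns [z * N x y] and its rotations into sums of two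
   powers, which recombine into the power sum of exponent [d + 3]. For odd [d] the factor [a d.+1]
   is zero. *)
have EN : x * y * z * (a d.+1 * (N x y + N y z + N z x)) =
    a d.+1 * (x ^+ d.+3 + y ^+ d.+3 + z ^+ d.+3).
  have [od|ev] := boolP (odd d).
    by rewrite cot_coef_even ?mul0r ?mulr0 //= negbK.
  have ez : z = - (x + y) by apply/eqP; rewrite -addr_eq0 addrC xyz.
  have Nxy : z * N x y = - (x ^+ d.+1 + y ^+ d.+1).
    by rewrite ez mulNr alt_power_sum.
  have Nyz : x * N y z = - (y ^+ d.+1 + z ^+ d.+1).
    by rewrite -alt_power_sum // -mulNr; congr (_ * _); rewrite ez; ring.
  have Nzx : y * N z x = - (z ^+ d.+1 + x ^+ d.+1).
    by rewrite -alt_power_sum // -mulNr; congr (_ * _); rewrite ez; ring.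
  rewrite !(exprS _ d.+2, exprS _ d.+1).
  move: (N x y) (N y z) (N z x) (x ^+ d.+1) (y ^+ d.+1) (z ^+ d.+1) Nxy Nyz Nzx.
  move=> n1 n2 n3 X1' Y1 Z1 Nxy Nyz Nzx.
  transitivity (a d.+1 * (x * y * (z * n1) + y * z * (x * n2) + z * x * (y * n3))).
    by ring.
  by rewrite Nxy Nyz Nzx ez; ring.
rewrite mulrBr EN.
move: E; rewrite !(exprS _ d.+2, exprS _ d.+1) => E.
have -> : k *+ (d == 0%N) = if d == 0%N then k else 0 by case: eqP.
move: (if _ then k else 0) E => k' E.
transitivity (x * y * z * (P x y + P y z + P z x - k') + x * y * z * k'
  - a d.+1 * (x * (x * x ^+ d.+1) + y * (y * y ^+ d.+1) + z * (z * z ^+ d.+1))).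
  by ring.
by rewrite E; ring.
Qed.

Lemma poly_eq0_nat (P : {poly F}) : (forall n : nat, P.[n.+1%:R] = 0) -> P = 0.
Proof.
move=> P0; apply/eqP; apply: contraT => Pn0.
pose rs : seq F := [seq i.+1%:R | i <- iota 0 (size P)].
have := max_poly_roots Pn0 (rs := rs); rewrite size_map size_iota ltnn => -> //.
  by apply/allP => v /mapP[i _ ->]; apply/rootP.
by rewrite map_inj_uniq ?iota_uniq // => i j /eqP; rewrite eqr_nat => /eqP [].
Qed.

(* Degree [d] forms in three variables of sum zero are polynomials of degree
   at most [d] in one of them, a second one being set to 1; this is how the
   scalar identity is transported to W. *)
Lemma cot_weight_action (V : lmodType F) (W : nat -> nat -> nat -> V) d :
  (forall i j e, W i.+1 j e + W i j.+1 e + W i j e.+1 = 0) ->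
  \sum_(i < d.+1) cot_weight d i *:
    (W i (d - i)%N 0%N + W 0%N i (d - i)%N + W (d - i)%N 0%N i)
  = (k *+ (d == 0%N)) *: W 0%N 0%N 0%N.
Proof.
(* [L] homogenises a polynomial in [x] to degree [d] by means of [y] and replaces each monomial by
   the corresponding value of [W]. *)
move=> HW; pose L (P : {poly F}) := \sum_(i < d.+1) P`_i *: W i (d - i)%N 0%N.
have LD P Q : L (P + Q) = L P + L Q.
  by rewrite -big_split; apply: eq_bigr => i _; rewrite coefD scalerDl.
have LZ c P : L (c *: P) = c *: L P.
  by rewrite scaler_sumr; apply: eq_bigr => i _; rewrite coefZ scalerA.
have L0 : L 0 = 0 by rewrite -(scale0r 0) LZ scale0r.
(* With [x = 'X] and [y = 1] this is the third variable [z = - x - y]. The hypothesis on [W]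
   expresses the same relation and removes the third exponent one unit at a time. *)
pose q : {poly F} := - 1 - 'X.
have LW i j e : (i + j + e = d)%N -> W i j e = L ('X^i * q ^+ e).
  elim: e i j => [|e IHe] i j eqd.
    have lt : (i < d.+1)%N by rewrite -eqd addn0 ltnS leq_addr.
    rewrite mulr1 /L (bigD1 (Ordinal lt)) //= coefXn eqxx scale1r.
    rewrite big1 => [|m ne].
      by rewrite addr0 -eqd addn0 addKn.
    rewrite coefXn; case: eqP => em; rewrite ?scale0r //.
    by case/eqP: ne; apply/val_inj.
  have /eqP := HW i j e; rewrite addrC addr_eq0 => /eqP ->.
  rewrite (IHe i.+1 j) ?(IHe i j.+1) -?LD; try by rewrite -eqd; ring.
  rewrite -scaleN1r -LZ; congr L; rewrite scaleN1r /q exprS.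
  by rewrite exprS; move: (q ^+ e) ('X^i) => u v; rewrite /q; ring.
pose P := \sum_(i < d.+1) cot_weight d i *:
  ('X^i + q ^+ (d - i)%N + q ^+ i * 'X^(d - i)).
transitivity (L P).
  rewrite /P (big_morph L LD L0); apply: eq_bigr => i _.
  have le : (i <= d)%N := leq_ord i.
  rewrite LZ !LD; congr (_ *: (_ + _ + _)).
  - by rewrite (LW i) ?mulr1 // addn0 subnKC.
  - by rewrite (LW 0%N) ?mul1r // add0n subnKC.
  - by rewrite (LW (d - i)%N) 1?mulrC // addn0 subnK.
have -> : P = (k *+ (d == 0%N)) *: 1.
  apply/eqP; rewrite -subr_eq0; apply/eqP; apply: poly_eq0_nat => n.
  (* At a positive integer [x] the three values [x], [1] and [- 1 - x] are nonzero, as the scalar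
     identity requires. *)
  set x : F := n.+1%:R; have x0 : x != 0 by rewrite pnatr_eq0.
  have qx : q.[x] = - 1 - x by rewrite /q !hornerE.
  clearbody q; have q0 : - 1 - x != 0.
    by rewrite -opprD oppr_eq0 -[1]/(1%:R) -natrD pnatr_eq0.
  rewrite hornerD hornerN hornerZ hornerC mulr1 /P horner_sum.
  rewrite -(@cot_weight_identity x 1 (- 1 - x) d) ?oner_eq0 //; last by ring.
  rewrite -sumrB big1 // => i _.
  rewrite !(hornerZ, hornerD, hornerM, hornerXn, horner_exp) qx.
  by rewrite !expr1n mulr1 mul1r subrr.
rewrite LZ; case: eqP => [d0|_]; last by rewrite !scale0r.
by congr (_ *: _); rewrite (LW 0%N 0%N 0%N) ?mul1r ?d0.
Qed.

End CotangentIdentity.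

(** * Tensors over a Lie algebra in coordinates *)

Section LieTensors.
Variables (R : comNzRingType) (N : nat) (s : 'I_N -> 'I_N -> 'I_N -> R).
Implicit Types (r : 'M[R]_N) (i j k : 'I_N).
Hypothesis s_anti : forall a b k, s a b k = - s b a k.
Hypothesis s_jacobi : forall a b c k, \sum_m s b c m * s a m k
  + \sum_m s c a m * s b m k + \sum_m s a b m * s c m k = 0.

(* [r^{1,3}, r'^{2,3}] *)
Definition ybr r r' i j k : R := \sum_a \sum_b s a b k * r i a * r' j b.

Definition cyc (T : 'I_N -> 'I_N -> 'I_N -> R) i j k : R :=
  T i j k + T j k i + T k i j.

Lemma cycD T T' i j k :
  cyc (fun i j k => T i j k + T' i j k) i j k = cyc T i j k + cyc T' i j k.
Proof. by rewrite /cyc; ring. Qed.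

Lemma skewE r i j : r^T = - r -> r i j = - r j i.
Proof. by move=> /matrixP/(_ j i); rewrite !mxE. Qed.

(** Skew-symmetry brings the brackets occurring in [CYB] to the single shape [ybr] at rotated
    indices; here two signs cancel. *)
Lemma ybr1213 r r' i j k : r^T = - r -> r'^T = - r' ->
  \sum_a \sum_b s a b i * r a j * r' b k = ybr r r' j k i.
Proof.
move=> h h'; apply: eq_bigr => a _; apply: eq_bigr => b _.
by rewrite (skewE a j h) (skewE b k h'); ring.
Qed.

Lemma ybr1223 r r' i j k : r^T = - r ->
  \sum_a \sum_b s a b j * r' i a * r b k = ybr r r' k i j.
Proof.
move=> h; rewrite exchange_big; apply: eq_bigr => a _; apply: eq_bigr => b _.
by rewrite s_anti (skewE a k h); ring.
Qed.

Lemma ybrD r r' r1 r1' i j k : ybr (r + r1) (r' + r1') i j k =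
  ybr r r' i j k + ybr r r1' i j k + ybr r1 r' i j k + ybr r1 r1' i j k.
Proof.
rewrite /ybr -!big_split; apply: eq_bigr => a _; rewrite -!big_split.
by apply: eq_bigr => b _; rewrite !mxE /=; ring.
Qed.

Definition adm a : 'M[R]_N := \matrix_(k, i) s a i k.

Definition tens_act a r : 'M[R]_N := adm a *m r + r *m (adm a)^T.

Lemma tens_actE a r i j :
  tens_act a r i j = \sum_x s a x i * r x j + \sum_x r i x * s a x j.
Proof.
rewrite !mxE; congr (_ + _); apply: eq_bigr => x _; rewrite !mxE //.
Qed.

(** A leg of [r] contracted with the adjoint action on [r'] gives two mixed brackets, one for each
    factor acted upon. For equivariant [r'] the action is a derivative, so mixed brackets become
    derivatives. *)
Lemma ybr_cross r r' i j k : r'^T = - r' ->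
  \sum_m r k m * tens_act m r' i j = ybr r' r j k i + ybr r r' k i j.
Proof.
move=> h; rewrite /ybr [X in _ = X + _]exchange_big -big_split.
apply: eq_bigr => m _; rewrite !mxE mulrDr !mulr_sumr.
congr (_ + _); apply: eq_bigr => a _; rewrite !mxE.
  by rewrite (s_anti m) (skewE a j h); ring.
by ring.
Qed.

Lemma exchange_big3 (G : 'I_N -> 'I_N -> 'I_N -> R) :
  \sum_a \sum_b \sum_c G a b c = \sum_b \sum_c \sum_a G a b c.
Proof. by rewrite exchange_big; apply: eq_bigr => b _; rewrite exchange_big. Qed.

(* The closedness of [L], contracted three times with its partial inverse. *)
Lemma ybr_closed_form r (L : 'M[R]_N) (chi : pred 'I_N) i j k :
  (forall i m, (r *m L) i m = - (chi i && (i == m))%:R) ->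
  (forall a b c, \sum_m L a m * s b c m + \sum_m L b m * s c a m
     + \sum_m L c m * s a b m = 0) ->
  cyc (fun i j k => (chi k)%:R * ybr r r i j k) i j k = 0.
Proof.
move=> rL HL.
pose U i j k := \sum_a \sum_b \sum_c r i a * r j b * r k c * \sum_m L a m * s b c m.
(* The product [r *m L] is minus the projector given by [chi], which collapses the sum over [a] and
   leaves one bracket. *)
have EU i' j' k' : U i' j' k' = - ((chi i')%:R * ybr r r j' k' i').
  transitivity (\sum_b \sum_c r j' b * r k' c * \sum_m (r *m L) i' m * s b c m).
    rewrite /U exchange_big3; apply: eq_bigr => b _; apply: eq_bigr => c _.
    rewrite mulr_sumr; under eq_bigr do rewrite mulr_sumr.
    rewrite exchange_big; apply: eq_bigr => m _; rewrite mxE mulr_suml mulr_sumr.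
    by apply: eq_bigr => a _; ring.
  rewrite /ybr mulr_sumr -sumrN; apply: eq_bigr => b _.
  rewrite mulr_sumr -sumrN; apply: eq_bigr => c _.
  rewrite (bigD1 i') //= big1 => [|m ne]; last first.
    by rewrite rL eq_sym (negPf ne) andbF oppr0 mul0r.
  by rewrite rL eqxx andbT; ring.
have U2 : U j k i = \sum_a \sum_b \sum_c
    r i a * r j b * r k c * \sum_m L b m * s c a m.
  rewrite [RHS]exchange_big3; do 3!apply: eq_bigr => ? _.
  by congr (_ * _); ring.
have U3 : U k i j = \sum_a \sum_b \sum_c
    r i a * r j b * r k c * \sum_m L c m * s a b m.
  rewrite -[RHS]exchange_big3; do 3!apply: eq_bigr => ? _.
  by congr (_ * _); ring.
have : U i j k + U j k i + U k i j = 0.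
  rewrite U2 U3 /U -!big_split /=.
  apply: big1 => a _; rewrite -!big_split; apply: big1 => b _.
  rewrite -!big_split; apply: big1 => c _ /=.
  by rewrite -!mulrDr HL mulr0.
rewrite !EU => /eqP; rewrite -!opprD oppr_eq0 => /eqP E.
by rewrite /cyc -[RHS]E; ring.
Qed.

Lemma adm_bracket a b :
  adm a *m adm b - adm b *m adm a = \sum_c s a b c *: adm c.
Proof.
apply/matrixP => k i; rewrite summxE !mxE.
under [RHS]eq_bigr do rewrite !mxE.
have := s_jacobi a b i k => /eqP; rewrite addr_eq0 => /eqP E.
have -> : \sum_c s a b c * s c i k = - \sum_m s a b m * s i m k.
  by rewrite -sumrN; apply: eq_bigr => m _; rewrite (s_anti i); ring.
rewrite -E; congr (_ + _).
  by apply: eq_bigr => m _; rewrite !mxE mulrC.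
rewrite -sumrN; apply: eq_bigr => m _; rewrite !mxE.
by rewrite (s_anti i a); ring.
Qed.

(** * The invariant tensor [t] and the bracket of its copies *)

Variable t : 'M[R]_N.
Hypothesis t_sym : t^T = t.
Hypothesis t_inv : forall a, adm a *m t + t *m (adm a)^T = 0.

Lemma tC i j : t i j = t j i. Proof. by rewrite -[in LHS]t_sym mxE. Qed.

Lemma adm_t a : t *m (adm a)^T = - (adm a *m t).
Proof. by apply/eqP; rewrite -addr_eq0 addrC t_inv. Qed.

(** The adjoint operator of the vector [sum_b t_(b k) e_b], along which [lam^vee] moves when the
    coordinate [k] of [lam] varies. *)
Definition adt k : 'M[R]_N := \sum_b t b k *: adm b.

Lemma adtE k i l : adt k i l = \sum_b t b k * s b l i.
Proof. by rewrite summxE; apply: eq_bigr => b _; rewrite !mxE. Qed.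

Lemma adt_tE k i j : (adt k *m t) i j = ybr t t k j i.
Proof.
rewrite mxE /ybr exchange_big; apply: eq_bigr => l _; rewrite adtE mulr_suml.
by apply: eq_bigr => b _; rewrite (tC l) (tC b); ring.
Qed.

Lemma adt_t k : t *m (adt k)^T = - (adt k *m t).
Proof.
rewrite /adt linear_sum mulmx_sumr mulmx_suml -sumrN; apply: eq_bigr => b _ /=.
by rewrite linearZ -scalemxAr adm_t -scalemxAl scalerN.
Qed.

Lemma ybrC i j k : ybr t t i j k = - ybr t t j i k.
Proof.
rewrite /ybr exchange_big -sumrN; apply: eq_bigr => a _; rewrite -sumrN.
by apply: eq_bigr => b _; rewrite (s_anti b); ring.
Qed.

(** Invariance of [t] makes the matrix [adt i *m t] skew. Together with the exchange of the first
    two indices, this makes [ybr t t] totally antisymmetric. *)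
Lemma ybrC23 i j k : ybr t t i j k = - ybr t t i k j.
Proof.
rewrite -!adt_tE -[RHS](_ : (- (adt i *m t)) j k = _); last by rewrite mxE.
rewrite -adt_t !mxE; apply: eq_bigr => l _; rewrite mxE.
by rewrite mulrC (tC j).
Qed.

Lemma ybr_rot i j k : ybr t t i j k = ybr t t j k i.
Proof. by rewrite ybrC ybrC23 opprK. Qed.

Definition act3 (A B C : 'M[R]_N) (T : 'I_N -> 'I_N -> 'I_N -> R) i j k : R :=
  \sum_a \sum_b \sum_c A i a * B j b * C k c * T a b c.

Lemma act3_rot A B C T i j k :
  act3 A B C T i j k = act3 B C A (fun j k i => T i j k) j k i.
Proof.
rewrite /act3 exchange_big3; apply: eq_bigr => b _; apply: eq_bigr => c _.
by apply: eq_bigr => a _; ring.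
Qed.

Lemma act3_mul1 A A' B C T i j k : act3 (A *m A') B C T i j k =
  act3 A B C (fun a j k => \sum_a' A' a a' * T a' j k) i j k.
Proof.
rewrite /act3; under eq_bigr => a _ do
  under eq_bigr => b _ do under eq_bigr => c _ do rewrite mxE !mulr_suml.
under [RHS]eq_bigr => a _ do
  under eq_bigr => b _ do under eq_bigr => c _ do rewrite mulr_sumr.
have E (G : 'I_N -> 'I_N -> 'I_N -> 'I_N -> R) :
   \sum_a \sum_b \sum_c \sum_d G a b c d = \sum_d \sum_b \sum_c \sum_a G a b c d.
  rewrite exchange_big3 [RHS]exchange_big3.
  by apply: eq_bigr => b _; apply: eq_bigr => c _; rewrite exchange_big.
rewrite E; do 4!apply: eq_bigr => ? _.
by ring.
Qed.

Lemma act3_mul2 A B B' C T i j k : act3 A (B *m B') C T i j k =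
  act3 A B C (fun i b k => \sum_b' B' b b' * T i b' k) i j k.
Proof. by rewrite act3_rot act3_mul1 [RHS]act3_rot. Qed.

Lemma act3_mul3 A B C C' T i j k : act3 A B (C *m C') T i j k =
  act3 A B C (fun i j c => \sum_c' C' c c' * T i j c') i j k.
Proof. by rewrite 2!act3_rot act3_mul1 [RHS]act3_rot [RHS]act3_rot. Qed.

Lemma eq_act3 A B C T T' i j k : (forall i j k, T i j k = T' i j k) ->
  act3 A B C T i j k = act3 A B C T' i j k.
Proof. by move=> E; do 3!apply: eq_bigr => ? _; rewrite E. Qed.

Lemma act3_0 A B C T i j k : (forall i j k, T i j k = 0) ->
  act3 A B C T i j k = 0.
Proof. by move=> E; do 3!apply: big1 => ? _; rewrite E mulr0. Qed.

Lemma act3D A B C T T' i j k :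
  act3 A B C (fun i j k => T i j k + T' i j k) i j k
  = act3 A B C T i j k + act3 A B C T' i j k.
Proof.
rewrite /act3 -big_split; apply: eq_bigr => a _ /=; rewrite -big_split.
apply: eq_bigr => b _ /=; rewrite -big_split; apply: eq_bigr => c _ /=.
by ring.
Qed.

(** Up to sign, [ybr t t] at third index [k] is the matrix [adt k *m t]. The action on its two
    matrix indices is the commutator of [adm a] with [adt k], followed by [t]; by Jacobi and the
    invariance of [t] it cancels the action on [k]. *)
Lemma ybr_invariant a i j k :
  \sum_m adm a i m * ybr t t m j k + \sum_m adm a j m * ybr t t i m k
  + \sum_m adm a k m * ybr t t i j m = 0.
Proof.
have E : adm a *m (adt k *m t) + (adt k *m t) *m (adm a)^T
    + \sum_m adm a k m *: (adt m *m t) = 0.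
  have -> : (adt k *m t) *m (adm a)^T = - (adt k *m adm a *m t).
    by rewrite -mulmxA adm_t mulmxN mulmxA.
  rewrite mulmxA -mulmxBl.
  have -> : adm a *m adt k - adt k *m adm a = \sum_c (adm a *m t) c k *: adm c.
    rewrite /adt mulmx_sumr mulmx_suml -sumrB.
    under eq_bigr => b _ do
      rewrite -scalemxAr -scalemxAl -scalerBr adm_bracket scaler_sumr.
    rewrite exchange_big; apply: eq_bigr => c _; rewrite mxE scaler_suml.
    by apply: eq_bigr => b _; rewrite !mxE scalerA mulrC.
  have -> : \sum_m adm a k m *: (adt m *m t)
      = (\sum_c (t *m (adm a)^T) c k *: adm c) *m t.
    under eq_bigr => m _ do rewrite scalemxAl /adt scaler_sumr.
    rewrite -mulmx_suml exchange_big; congr (_ *m _).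
    apply: eq_bigr => c _; rewrite mxE scaler_suml; apply: eq_bigr => b _.
    by rewrite scalerA !mxE mulrC.
  rewrite -mulmxDl -big_split big1 ?mul0mx // => c _ /=.
  by rewrite -scalerDl adm_t !mxE subrr scale0r.
have anti x y z : ybr t t x y z = - ybr t t z y x.
  by rewrite ybr_rot ybrC ybr_rot.
pose M c := adt c *m t.
have EM c x y : M c x y = - ybr t t x y c by rewrite /M adt_tE anti.
move: E; rewrite -/(M k) -[\sum_m _]/(\sum_m adm a k m *: M m).
move: M EM => M EM /matrixP/(_ i j); rewrite !mxE summxE => E.
rewrite -[RHS]oppr0 -[X in _ = - X]E !opprD; congr (_ + _ + _);
  rewrite -sumrN; apply: eq_bigr => m _; rewrite ?[(_ *: M m) i j]mxE EM.
- by rewrite mulrN opprK.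
- by rewrite mulNr opprK !mxE mulrC.
- by rewrite mulrN opprK.
Qed.

(** * Powers of the adjoint operator of a vector [v] *)

Variables (v : 'I_N -> R).
Definition lie_mx : 'M[R]_N := \sum_b v b *: adm b.
Local Notation A := lie_mx.

(** The operator [A] is skew with respect to the invariant [t]: each factor is transposed and
    changes sign when it crosses [t]. *)
Lemma A_t n : A ^+ n *m t = (-1) ^+ n *: (t *m (A ^+ n)^T).
Proof.
have At : A *m t = - (t *m A^T).
  rewrite /lie_mx mulmx_suml linear_sum mulmx_sumr -sumrN; apply: eq_bigr => b _ /=.
  by rewrite linearZ -scalemxAr adm_t -scalemxAl scalerN opprK.
elim: n => [|n IHn]; first by rewrite !expr0 scale1r trmx1 mulmx1 mul1mx.
rewrite exprSr -[A ^+ n * A]/(A ^+ n *m A) -mulmxA At mulmxN mulmxA IHn.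
rewrite -scalemxAl -scalerN exprS mulN1r scaleNr scalerN; congr (- (_ *: _)).
rewrite -mulmxA -trmx_mul; congr (_ *m _^T).
exact: etrans (esym (exprS A n)) (exprSr A n).
Qed.

(* The tensor acted upon is [[t^{1,3}, t^{2,3}] = - Z]. *)
Definition powact x y z := act3 (A ^+ x) (A ^+ y) (A ^+ z) (ybr t t).

Lemma powact_rot x y z i j k : powact x y z i j k = powact y z x j k i.
Proof.
by rewrite /powact act3_rot; apply: eq_act3 => *; apply: ybr_rot.
Qed.

(** The additional factor [A] acts first, in each of the three places in turn, and the sum of these
    actions kills the invariant tensor. *)
Lemma powact_sum0 x y z i j k :
  powact x.+1 y z i j k + powact x y.+1 z i j k + powact x y z.+1 i j k = 0.
Proof.
rewrite /powact !exprSr act3_mul1 act3_mul2 act3_mul3 -!act3D; apply: act3_0.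
move=> {}i {}j {}k; rewrite /lie_mx.
transitivity (\sum_b v b * (\sum_m adm b i m * ybr t t m j k
   + \sum_m adm b j m * ybr t t i m k + \sum_m adm b k m * ybr t t i j m)).
  have E l (G : 'I_N -> R) : \sum_m (\sum_b v b *: adm b) l m * G m
      = \sum_b v b * \sum_m adm b l m * G m.
    under eq_bigr do rewrite summxE mulr_suml.
    rewrite exchange_big; apply: eq_bigr => b _; rewrite mulr_sumr.
    by apply: eq_bigr => m _; rewrite mxE mulrA.
  by rewrite !E -!big_split; apply: eq_bigr => b _ /=; rewrite !mulrDr.
by apply: big1 => b _; rewrite ybr_invariant mulr0.
Qed.

Lemma powact000 i j k : powact 0 0 0 i j k = ybr t t i j k.
Proof.
rewrite /powact /act3 (bigD1 i) //= [X in _ + X]big1 => [|a /negPf ne]; last first.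
  by do 2!apply: big1 => ? _; rewrite mxE eq_sym ne !mul0r.
rewrite (bigD1 j) //= [X in _ + X + _]big1 => [|a /negPf ne]; last first.
  by apply: big1 => ? _; rewrite [X in _ * X * _ * _]mxE eq_sym ne mulr0 !mul0r.
rewrite (bigD1 k) //= [X in _ + X + _ + _]big1 => [|a /negPf ne]; last first.
  by rewrite [X in _ * X * _]mxE eq_sym ne mulr0 !mul0r.
by rewrite !mxE !eqxx !mul1r !addr0.
Qed.

Lemma powact_xy0 x y i j k : powact x y 0 i j k =
  \sum_a \sum_b (A ^+ x) i a * (A ^+ y) j b * ybr t t a b k.
Proof.
apply: eq_bigr => a _; apply: eq_bigr => b _.
rewrite (bigD1 k) //= big1 => [|c /negPf ne].
  by rewrite mxE eqxx mulr1 addr0.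
by rewrite [X in _ * X * _]mxE eq_sym ne mulr0 !mul0r.
Qed.

Lemma ybr_pow x y i j k :
  ybr (A ^+ x *m t) (A ^+ y *m t) i j k = powact x y 0 i j k.
Proof.
rewrite powact_xy0 /ybr.
have E r r' : \sum_a \sum_b s a b k * (r *m t) i a * (r' *m t) j b
   = \sum_a' \sum_b' r i a' * r' j b' * \sum_a \sum_b s a b k * t a' a * t b' b.
  under [RHS]eq_bigr => a' _ do under eq_bigr => b' _ do rewrite mulr_sumr.
  under [RHS]eq_bigr => a' _ do (rewrite exchange_big; under eq_bigr => a _ do
    under eq_bigr => b' _ do rewrite mulr_sumr).
  rewrite [RHS]exchange_big; apply: eq_bigr => a _ /=.
  under [RHS]eq_bigr => a' _ do rewrite exchange_big.
  rewrite [RHS]exchange_big; apply: eq_bigr => b _ /=.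
  rewrite !mxE -mulrA mulr_suml mulr_sumr; apply: eq_bigr => a' _.
  by rewrite !mulr_sumr; apply: eq_bigr => b' _; ring.
exact: E.
Qed.

(** Carrying [A ^+ y] across [t] moves it to the second factor and creates the alternating sign
    found in [cot_weight]. *)
Lemma adt_pow x y i j k : (A ^+ x *m adt k *m A ^+ y *m t) i j =
  - ((-1) ^+ y * powact x y 0 i j k).
Proof.
rewrite -mulmxA A_t -scalemxAr mulmxA -[_ *m adt k *m t]mulmxA mxE -mulrN.
congr (_ * _); rewrite powact_xy0 mxE exchange_big -sumrN.
apply: eq_bigr => b _; rewrite !mxE mulr_suml -sumrN; apply: eq_bigr => a _.
by rewrite adt_tE [ybr t t k b a]ybr_rot ybrC ybr_rot -ybr_rot -ybr_rot; ring.
Qed.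

(** Invariance means that [t] intertwines the coadjoint and adjoint actions: the left-hand side is
    the coordinate of [[e_m, lam^vee]] along [e_b]. *)
Lemma coadjoint_pairing (lam : 'I_N -> R) m b :
  \sum_a s m a b * (\sum_c t c a * lam c)
  = - \sum_a t b a * (\sum_c s m a c * lam c).
Proof.
have E c : \sum_a s m a b * t c a = - \sum_a t b a * s m a c.
  have /matrixP/(_ b c) := adm_t m; rewrite !mxE => /eqP.
  rewrite -eqr_oppLR => /eqP E; transitivity (\sum_j adm m b j * t j c).
    by apply: eq_bigr => a _; rewrite mxE tC.
  by rewrite -E; congr (- _); apply: eq_bigr => a _; rewrite !mxE.
transitivity (\sum_c (\sum_a s m a b * t c a) * lam c).
  under eq_bigr do rewrite mulr_sumr; rewrite exchange_big.
  apply: eq_bigr => c _; rewrite mulr_suml.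
  by apply: eq_bigr => a _; rewrite mulrA.
under eq_bigr do rewrite E mulNr; rewrite sumrN; congr (- _).
under [RHS]eq_bigr do rewrite mulr_sumr; rewrite [RHS]exchange_big.
apply: eq_bigr => c _; rewrite mulr_suml.
by apply: eq_bigr => a _; rewrite mulrA.
Qed.

(* [(a, b) |-> lam ([e_a, e_b])] *)
Definition form_mx (lam : 'I_N -> R) : 'M[R]_N :=
  \matrix_(a, b) \sum_c s a b c * lam c.

Lemma form_mx_closed lam a b c : \sum_m form_mx lam a m * s b c m
  + \sum_m form_mx lam b m * s c a m + \sum_m form_mx lam c m * s a b m = 0.
Proof.
have E x y z : \sum_m form_mx lam x m * s y z m
    = \sum_k lam k * \sum_m s y z m * s x m k.
  under eq_bigr do rewrite mxE mulr_suml; rewrite exchange_big.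
  apply: eq_bigr => k _; rewrite mulr_sumr; apply: eq_bigr => m _.
  by ring.
rewrite !E -!big_split big1 // => k _ /=.
by rewrite -!mulrDr s_jacobi mulr0.
Qed.

(** As [r] inverts the form up to sign, it combines the displacements [[e_m, lam^vee]] into the
    vector [sum_b t_(b k) e_b], for [k] in [chi]. *)
Lemma coadjoint_invert r (lam : 'I_N -> R) (chi : pred 'I_N) k b :
  (forall i m, (r *m form_mx lam) i m = - (chi i && (i == m))%:R) ->
  \sum_m r k m * (\sum_a s m a b * (\sum_c t c a * lam c))
  = (chi k)%:R * t b k.
Proof.
move=> H; transitivity (- \sum_a t b a * (r *m form_mx lam) k a).
  rewrite -sumrN; under eq_bigr do rewrite coadjoint_pairing -sumrN mulr_sumr.
  rewrite exchange_big; apply: eq_bigr => a _; rewrite mxE mulr_sumr -sumrN.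
  by apply: eq_bigr => m _; rewrite mxE; ring.
rewrite (bigD1 k) //= big1 => [|a ne]; last first.
  by rewrite H eq_sym (negPf ne) andbF oppr0 mulr0.
by rewrite H eqxx andbT addr0 mulrN opprK mulrC.
Qed.

(* The derivative of [A ^+ d *m t] when [A] moves in the direction [B]. *)
Definition derp (B : 'M[R]_N) d : 'M[R]_N :=
  \sum_(x < d) A ^+ x *m B *m A ^+ (d.-1 - x)%N *m t.

Lemma derp_sum (u : 'I_N -> R) d :
  \sum_b u b *: derp (adm b) d = derp (\sum_b u b *: adm b) d.
Proof.
rewrite /derp; under eq_bigr do rewrite scaler_sumr.
rewrite exchange_big; apply: eq_bigr => x _.
rewrite mulmx_sumr !mulmx_suml; apply: eq_bigr => b _.
by rewrite -scalemxAr -!scalemxAl.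
Qed.

Lemma derp_adt d i j k : \sum_b t b k * derp (adm b) d.+1 i j =
  - \sum_(x < d.+1) (-1) ^+ (d - x)%N * powact x (d - x)%N 0 i j k.
Proof.
transitivity (derp (adt k) d.+1 i j).
  rewrite /adt -derp_sum summxE; apply: eq_bigr => b _.
  by rewrite [RHS]mxE.
by rewrite summxE -sumrN; apply: eq_bigr => x _; rewrite adt_pow.
Qed.

(** Moving [A] along its commutator with [adm m] makes the Leibniz sum telescope to the commutator
    of [adm m] with [A ^+ d]; invariance of [t] turns this into the action on the tensor. *)
Lemma derp_equivariant m d :
  \sum_b (\sum_a s m a b * v a) *: derp (adm b) d = tens_act m (A ^+ d *m t).
Proof.
rewrite derp_sum.
have -> : \sum_b (\sum_a s m a b * v a) *: adm b = adm m *m A - A *m adm m.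
  rewrite /lie_mx mulmx_sumr mulmx_suml -sumrB.
  under [RHS]eq_bigr => b _ do
    rewrite -scalemxAr -scalemxAl -scalerBr adm_bracket scaler_sumr.
  rewrite exchange_big; apply: eq_bigr => c _; rewrite scaler_suml.
  by apply: eq_bigr => b _; rewrite scalerA mulrC.
have -> : tens_act m (A ^+ d *m t) = (adm m *m A ^+ d - A ^+ d *m adm m) *m t.
  by rewrite /tens_act -[A ^+ d *m t *m _]mulmxA adm_t mulmxBl mulmxN !mulmxA.
rewrite /derp -mulmx_suml; congr (_ *m _).
pose w x : 'M[R]_N := A ^+ x *m adm m *m A ^+ (d - x)%N.
transitivity (\sum_(0 <= x < d) (w x - w x.+1)); last first.
  case: (posnP d) => [->|d0].
    by rewrite big_geq // !expr0 mulmx1 mul1mx subrr.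
  rewrite -[LHS]opprK -sumrN; under eq_bigr do rewrite opprB.
  by rewrite telescope_sumr // opprB /w subnn subn0 !expr0 mul1mx mulmx1.
rewrite big_mkord; apply: eq_bigr => x _; rewrite /w.
have -> : (d - x = (d.-1 - x).+1)%N.
  have x_lt := ltn_ord x; rewrite -subSn ?prednK ?(leq_ltn_trans _ x_lt) //.
  by rewrite -ltnS prednK // (leq_ltn_trans _ x_lt).
have -> : (d - x.+1 = d.-1 - x)%N by rewrite subnS -subn1 subnAC subn1.
rewrite exprS exprSr -[_ * A]/(_ *m A) -[A * _]/(A *m _).
by rewrite mulmxBr mulmxBl !mulmxA.
Qed.

End LieTensors.

(** * The inverse of omega *)

Section FractionDerivative.
Variables (F : fieldType) (n : nat).
Local Notation K := {fraction mfps F n}.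
Implicit Types (a b : mfps F n) (x y : K).

Lemma mfps_derivD i a b :
  mfps_deriv i (a + b) = mfps_deriv i a + mfps_deriv i b.
Proof. by apply/mfpsP => m; rewrite /= mulrnDl. Qed.

Lemma mfps_deriv_of i (P : {mpoly F[n]}) :
  mfps_deriv i (mfps_of P) = mfps_of P^`M(i).
Proof. by apply/mfpsP => m; rewrite /= mcoeff_deriv. Qed.

Lemma frac_deriv_tofrac i a : frac_deriv i (tofrac a) = tofrac (mfps_deriv i a).
Proof.
have E : mfps_deriv i (1 : mfps F n) = 0.
  by rewrite -[1](rmorph1 (@mfps_of F n)) mfps_deriv_of mderivC rmorph0.
have := frac_derivE i a (oner_neq0 _).
by rewrite tofrac1 E mulr0 subr0 expr1n !divr1 mulr1.
Qed.

Lemma frac_derivP x : exists a b, b != 0 /\ x = tofrac a / tofrac b.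
Proof.
exists \n_(repr x), \d_(repr x); split; first exact: denom_ratioP.
exact: frac_numden.
Qed.

Lemma frac_derivD i x y : frac_deriv i (x + y) = frac_deriv i x + frac_deriv i y.
Proof.
have [a [b [b0 ->]]] := frac_derivP x; have [c [d [d0 ->]]] := frac_derivP y.
have [fb0 fd0] := (tofrac_neq0 b0, tofrac_neq0 d0).
have -> : tofrac a / tofrac b + tofrac c / tofrac d
    = tofrac (a * d + c * b) / tofrac (b * d).
  by rewrite addf_div // tofracD !tofracM.
rewrite !frac_derivE ?mulf_neq0 // !(mfps_derivM, mfps_derivD).
rewrite !(tofracD, tofracN, tofracM).
have E (L : fieldType) (a' b' c' d' da db dc dd : L) : b' != 0 -> d' != 0 ->
    ((da * d' + a' * dd + (dc * b' + c' * db)) * (b' * d')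
      - (a' * d' + c' * b') * (db * d' + b' * dd)) / (b' * d') ^+ 2
    = (da * b' - a' * db) / b' ^+ 2 + (dc * d' - c' * dd) / d' ^+ 2.
  by move=> b0' d0'; field; rewrite b0' d0'.
exact: E.
Qed.

Lemma frac_derivM i x y :
  frac_deriv i (x * y) = frac_deriv i x * y + x * frac_deriv i y.
Proof.
have [a [b [b0 ->]]] := frac_derivP x; have [c [d [d0 ->]]] := frac_derivP y.
have [fb0 fd0] := (tofrac_neq0 b0, tofrac_neq0 d0).
have -> : tofrac a / tofrac b * (tofrac c / tofrac d)
    = tofrac (a * c) / tofrac (b * d).
  by rewrite mulf_div !tofracM.
rewrite !frac_derivE ?mulf_neq0 // !mfps_derivM.
rewrite !(tofracD, tofracN, tofracM).
have E (L : fieldType) (a' b' c' d' da db dc dd : L) : b' != 0 -> d' != 0 ->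
    ((da * c' + a' * dc) * (b' * d') - a' * c' * (db * d' + b' * dd))
      / (b' * d') ^+ 2
    = (da * b' - a' * db) / b' ^+ 2 * (c' / d')
      + a' / b' * ((dc * d' - c' * dd) / d' ^+ 2).
  by move=> b0' d0'; field; rewrite b0' d0'.
exact: E.
Qed.

Lemma frac_deriv0 i : frac_deriv i (0 : K) = 0.
Proof. by apply: (addrI (frac_deriv i 0)); rewrite -frac_derivD !addr0. Qed.

Lemma frac_deriv_loc i (P : {mpoly F[n]}) :
  frac_deriv i (loc_of P) = loc_of P^`M(i).
Proof. by rewrite /loc_of frac_deriv_tofrac mfps_deriv_of. Qed.

Lemma frac_deriv_sum i I (r : seq I) (G : I -> K) :
  frac_deriv i (\sum_(j <- r) G j) = \sum_(j <- r) frac_deriv i (G j).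
Proof. exact: (big_morph _ (@frac_derivD i) (@frac_deriv0 i)). Qed.

(* Differentiating [w O = -1] gives [dw = w dO w]. *)
Lemma frac_deriv_inverse i q (w O : 'M[K]_q) : O *m w = - 1%:M ->
  map_mx (frac_deriv i) w = w *m map_mx (frac_deriv i) O *m w.
Proof.
move=> Ow; have wO : w *m O = - 1%:M.
  have /mulmx1C : O *m (- w) = 1%:M by rewrite mulmxN Ow opprK.
  by rewrite mulNmx => E; rewrite -E opprK.
have D1 : map_mx (frac_deriv i) (- 1%:M : 'M[K]_q) = 0.
  apply/matrixP => a b; rewrite !mxE.
  have -> : - (a == b)%:R = loc_of (- (a == b)%:R)%:MP :> K.
    by rewrite mpolyCN mpolyC_nat rmorphN rmorph_nat.
  by rewrite frac_deriv_loc mderivC rmorph0.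
have : map_mx (frac_deriv i) w *m O + w *m map_mx (frac_deriv i) O = 0.
  rewrite -D1 -wO; apply/matrixP => a b; rewrite !mxE frac_deriv_sum -big_split.
  by apply: eq_bigr => c _; rewrite !mxE frac_derivM.
move/(congr1 (fun M => M *m w)); rewrite mul0mx mulmxDl -mulmxA Ow mulmxN mulmx1.
by move/eqP; rewrite addrC subr_eq0 => /eqP ->.
Qed.

End FractionDerivative.

Lemma split_lshift m n (i : 'I_m) : split (lshift n i) = inl i.
Proof. exact: (unsplitK (inl i)). Qed.

Lemma split_rshift m n (i : 'I_n) : split (rshift m i) = inr i.
Proof. exact: (unsplitK (inr i)). Qed.

(** * Structure constants of the splitting, and the tensor [r] as partial inverse of [lam
    ([.,.])] *)

Section StructureConstants.
Variables (F : fieldType) (g : vectType F) (br : lie_bracket g).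
Variables (l u : {vspace g}) (p q : nat) (el : p.-tuple g) (eu : q.-tuple g).
Hypotheses (bl : basis_of l el) (bu : basis_of u eu).
Hypothesis (spl : splitting br l u).

Local Notation N := (p + q)%N.
Local Notation K := {fraction mfps F p}.
Local Notation e := (basis_g el eu).
Local Notation sc := (struct_cst br el eu).

Lemma lie_antisym x y : br x y = - br y x.
Proof.
apply/eqP; rewrite -addr_eq0; have := lie_alt br (x + y).
have := lie_linearl br (x + y) 1 x y; rewrite !scale1r => ->.
have := lie_linearr br x 1 x y; have := lie_linearr br y 1 x y.
by rewrite !scale1r => -> ->; rewrite !lie_alt addr0 add0r => ->.
Qed.

Lemma lie_sumr (I : finType) x (c : I -> F) (G : I -> g) :
  br x (\sum_i c i *: G i) = \sum_i c i *: br x (G i).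
Proof.
have D : {morph br x : y z / y + z}.
  by move=> y z; have := lie_linearr br x 1 y z; rewrite !scale1r.
have br0 : br x 0 = 0 by apply: (addrI (br x 0)); rewrite -D !addr0.
rewrite (big_morph _ D br0); apply: eq_bigr => i _.
by have := lie_linearr br x (c i) (G i) 0; rewrite br0 !addr0.
Qed.

Lemma basis_g_full : basis_of fullv e.
Proof.
have [<- /eqP ulI _ _] := spl; apply: cat_basis => //.
by apply/directv_addP; apply/eqP.
Qed.

Lemma basis_gE x : x = \sum_k coord e k x *: e`_k.
Proof. by rewrite {1}(coord_basis basis_g_full (memvf x)). Qed.

Lemma struct_anti a b k : sc a b k = - sc b a k.
Proof. by rewrite /struct_cst lie_antisym linearN. Qed.

Lemma struct_jacobi a b c k : \sum_m sc b c m * sc a m k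
  + \sum_m sc c a m * sc b m k + \sum_m sc a b m * sc c m k = 0.
Proof.
have E x y z : \sum_m sc y z m * sc x m k = coord e k (br e`_x (br e`_y e`_z)).
  rewrite [br e`_y e`_z]basis_gE lie_sumr linear_sum; apply: eq_bigr => m _.
  by rewrite linearZ.
by rewrite !E -!linearD lie_jacobi linear0.
Qed.

Lemma basis_g_lshift (h : 'I_p) : e`_(lshift q h) = el`_h.
Proof. by rewrite /= nth_cat size_tuple ltn_ord. Qed.

Lemma basis_g_rshift (j : 'I_q) : e`_(rshift p j) = eu`_j.
Proof. by rewrite /= nth_cat size_tuple ltnNge leq_addr /= addKn. Qed.

Lemma coord_proj_l x (h : 'I_p) :
  coord e (lshift q h) x = coord el h (daddv_pi l u x).
Proof.
have [_ ulI _ _] := spl; rewrite {2}(basis_gE x) big_split_ord linearD /=.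
rewrite [X in _ + X](_ : _ = 0) ?addr0; last first.
  set y := \sum_i _; have yu : y \in u.
    apply: memv_suml => i _; rewrite memvZ // -/(nth _ _ (rshift p i)).
    by rewrite basis_g_rshift (basis_mem bu) // mem_nth // size_tuple.
  (* The projections of [y] to [u] and [l] add up to [y], and the first is [y] itself; hence the
     second vanishes. *)
  have ull : (u :&: l = 0)%VS by rewrite capvC.
  have := daddv_pi_add ulI (subvP (addvSr l u) _ yu).
  rewrite (daddv_pi_id ull yu) => /eqP.
  by rewrite -subr_eq0 addrK => /eqP.
rewrite daddv_pi_id //; last first.
  apply: memv_suml => i _; rewrite memvZ // -/(nth _ _ (lshift q i)).
  by rewrite basis_g_lshift (basis_mem bl) // mem_nth // size_tuple.
under eq_bigr do rewrite -/(nth _ _ (lshift q _)) basis_g_lshift.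
by rewrite coord_sum_free // (basis_free bl).
Qed.

Lemma struct_lul (a : 'I_q) (b h : 'I_p) :
  sc (rshift p a) (lshift q b) (lshift q h) = 0.
Proof.
have [_ ulI _ lu_u] := spl; rewrite struct_anti /struct_cst coord_proj_l.
rewrite basis_g_lshift basis_g_rshift.
have xu : br el`_b eu`_a \in u.
  by apply: lu_u; [apply: (basis_mem bl)|apply: (basis_mem bu)];
    rewrite mem_nth // size_tuple.
have ull : (u :&: l = 0)%VS by rewrite capvC.
have := daddv_pi_add ulI (subvP (addvSr l u) _ xu).
rewrite (daddv_pi_id ull xu) => /eqP; rewrite -subr_eq0 addrK => /eqP ->.
by rewrite linear0 oppr0.
Qed.

Lemma ad_mx_struct (a : 'I_N) : ad_mx br el eu e`_a = adm sc a.
Proof. by apply/matrixP => k i; rewrite !mxE. Qed.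

Definition in_u (k : 'I_N) := if split k is inr _ then true else false.

Definition lam_loc (a : 'I_N) : K := loc_of (lam_gen F a).

Local Notation sK := (fun a b k => loc_of (sc a b k)%:MP : K).

Variable w : 'M[K]_q.
Hypothesis w_r : is_r_matrix br l u el eu w.
Local Notation sg := (block_mx 0 0 0 w : 'M[K]_(p + q)).

Lemma sg0l i j : sg (lshift q i) j = 0.
Proof.
by case: (split_ordP j) => j' ->; rewrite ?block_mxEul ?block_mxEur mxE.
Qed.

Lemma sg0r i j : sg i (lshift q j) = 0.
Proof.
by case: (split_ordP i) => i' ->; rewrite ?block_mxEul ?block_mxEdl mxE.
Qed.

Lemma omega_struct i j :
  form_mx sK lam_loc (rshift p i) (rshift p j)
  = loc_of (sym_of el (br_l br l u eu`_i eu`_j)).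
Proof.
rewrite mxE big_split_ord /= [X in _ + X]big1 => [|k _]; last first.
  by rewrite /lam_loc /lam_gen split_rshift rmorph0 mulr0.
rewrite addr0 /sym_of rmorph_sum; apply: eq_bigr => k _ /=.
rewrite -mul_mpolyC rmorphM /lam_loc /lam_gen split_lshift.
congr (loc_of _%:MP * _).
by rewrite /struct_cst coord_proj_l !basis_g_rshift.
Qed.

(** The bracket of [l] and [u] lies in [u], which [lam] annihilates. *)
Lemma form_lul i j : form_mx sK lam_loc (rshift p i) (lshift q j) = 0.
Proof.
rewrite mxE big_split_ord /= !big1 ?addr0 // => h _.
  by rewrite /lam_loc /lam_gen split_rshift rmorph0 mulr0.
by rewrite struct_lul rmorph0 mul0r.
Qed.

Lemma omega_w : (\matrix_(i, j) form_mx sK lam_loc (rshift p i) (rshift p j)) *m w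
  = - 1%:M.
Proof.
have [_ _ H] := w_r; apply/matrixP => i j; rewrite !mxE.
have iu : eu`_i \in u by rewrite (basis_mem bu) // mem_nth // size_tuple.
rewrite -[RHS]/(- (i == j)%:R).
transitivity (- loc_of (coord eu j eu`_i)%:MP : K).
  by rewrite -H //; apply: eq_bigr => k _; rewrite mxE omega_struct.
by rewrite coord_free ?(basis_free bu) // eq_sym; case: eqP;
  rewrite ?rmorph1 ?rmorph0.
Qed.

(** Since [u] and [l] are orthogonal for the form, inverting its block on [u] gives minus the
    projector on the indices of [u]. *)
Lemma sg_form i m : (sg *m form_mx sK lam_loc) i m = - (in_u i && (i == m))%:R.
Proof.
rewrite mxE big_split_ord /= /in_u; case: (split_ordP i) => i' ->.
  rewrite !big1 ?addr0 ?oppr0 // => k _.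
    by rewrite sg0l mul0r.
  by rewrite sg0l mul0r.
rewrite big1 ?add0r => [|k _]; last by rewrite sg0r mul0r.
case: (split_ordP m) => m' ->.
  rewrite eq_rlshift andbF oppr0 big1 // => k _.
  by rewrite form_lul mulr0.
rewrite eq_rshift /=.
(* For square matrices the one-sided inverse relation [omega_w] also holds on the other side. *)
have := mulmx1C (_ : (- \matrix_(i, j)
  form_mx sK lam_loc (rshift p i) (rshift p j)) *m w = 1%:M).
rewrite mulNmx omega_w opprK => /(_ erefl) /matrixP/(_ i' m').
rewrite mulmxN !mxE => /eqP; rewrite eqr_oppLR => /eqP <-.
by apply: eq_bigr => k _; rewrite block_mxEdr; congr (_ * _); rewrite [RHS]mxE.
Qed.

Lemma lam_loc_deriv h k : frac_deriv h (lam_loc k) = (k == lshift q h)%:R.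
Proof.
rewrite /lam_loc /lam_gen; case: (split_ordP k) => k' ->.
  rewrite frac_deriv_loc mderivX eq_lshift mnm1E.
  case: eqP => [->|_]; last by rewrite scale0r rmorph0.
  by rewrite -mul_mpolyC -{1}[U_(h)%MM]add0m addmK mpolyX0 mulr1 rmorph1.
by rewrite rmorph0 frac_deriv0 eq_rlshift.
Qed.

(** In [dw = w dO w], the derivative of the linear entries of [O] along ['X_h] is the structure
    constant with value in [el_h]; skewness of [w] gives the sign. *)
Lemma sg_deriv h i j :
  frac_deriv h (sg i j) = - ybr sK sg sg i j (lshift q h).
Proof.
have wT : w^T = - w by case: w_r.
rewrite /ybr; case: (split_ordP i) => i' ->.
  rewrite sg0l frac_deriv0 big1 ?oppr0 // => a _; apply: big1 => b _.
  by rewrite sg0l mulr0 mul0r.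
case: (split_ordP j) => j' ->.
  rewrite sg0r frac_deriv0 big1 ?oppr0 // => a _; apply: big1 => b _.
  by rewrite sg0l mulr0.
rewrite block_mxEdr.
have /matrixP/(_ i' j') := frac_deriv_inverse h omega_w.
rewrite [X in X = _]mxE => ->.
have -> : \sum_a \sum_b sK a b (lshift q h) * sg (rshift p i') a
      * sg (rshift p j') b
    = - \sum_(a < q) \sum_(b < q)
      w i' a * sK (rshift p a) (rshift p b) (lshift q h) * w b j'.
  rewrite big_split_ord /= big1 => [|a _]; last first.
    by apply: big1 => b _; rewrite sg0r mulr0 mul0r.
  rewrite add0r -sumrN; apply: eq_bigr => a _.
  rewrite big_split_ord /= big1 => [|b _]; last by rewrite sg0r mulr0.
  rewrite add0r -sumrN; apply: eq_bigr => b _; rewrite !block_mxEdr.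
  by rewrite (skewE b j' wT); ring.
rewrite opprK mxE.
rewrite exchange_big; apply: eq_bigr => b _; rewrite mxE mulr_suml.
apply: eq_bigr => a _; congr (_ * _ * _); rewrite !mxE frac_deriv_sum.
rewrite (bigD1 (lshift q h)) //= big1 => [|k ne].
  rewrite frac_derivM lam_loc_deriv eqxx frac_deriv_loc mderivC rmorph0.
  by rewrite mul0r add0r mulr1 addr0.
rewrite frac_derivM lam_loc_deriv (negPf ne) frac_deriv_loc mderivC rmorph0.
by rewrite mul0r mulr0 addr0.
Qed.

End StructureConstants.

(** * The cotangent term *)

Lemma mderiv_bigsum (R : nzRingType) n (i : 'I_n) (I : finType)
    (G : I -> {mpoly R[n]}) :
  (\sum_j G j)^`M(i) = \sum_j (G j)^`M(i).
Proof. exact: (raddf_sum (mderiv i)). Qed.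

Lemma scale_mx_expr (R : comNzRingType) n (x : R) (B : 'M[R]_n) d :
  (x *: B) ^+ d = x ^+ d *: B ^+ d.
Proof.
elim: d => [|d IHd]; first by rewrite !expr0 scale1r.
rewrite !exprS IHd -[LHS]/((x *: B) *m (x ^+ d *: B ^+ d)).
by rewrite -scalemxAl -scalemxAr scalerA.
Qed.

(** * Transport of the Lie and invariance relations to another coefficient ring *)

Section MorphicStructure.
Variables (F : fieldType) (g : vectType F) (br : lie_bracket g).
Variables (l u : {vspace g}) (p q : nat) (el : p.-tuple g) (eu : q.-tuple g).
Hypotheses (bl : basis_of l el) (bu : basis_of u eu).
Hypothesis (spl : splitting br l u).
Variables (t : 'M[F]_(p + q)) (t_inv : sym_invariant br el eu t).
Variables (R : comNzRingType) (h : {rmorphism F -> R}).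
Local Notation sh := (fun a b k => h (struct_cst br el eu a b k)).

Lemma morph_anti a b k : sh a b k = - sh b a k.
Proof. by rewrite /= struct_anti rmorphN. Qed.

Lemma morph_jacobi a b c k : \sum_m sh b c m * sh a m k
  + \sum_m sh c a m * sh b m k + \sum_m sh a b m * sh c m k = 0.
Proof.
rewrite -[RHS](rmorph0 h) -(struct_jacobi bl bu spl a b c k) !rmorphD !rmorph_sum.
by congr (_ + _ + _); apply: eq_bigr => m _; rewrite rmorphM.
Qed.

Lemma morph_sym : (map_mx h t)^T = map_mx h t.
Proof. by have [tT _] := t_inv; rewrite matrix.map_trmx tT. Qed.

Lemma morph_inv a : adm sh a *m map_mx h t + map_mx h t *m (adm sh a)^T = 0.
Proof.
have [_ /(_ (basis_g el eu)`_a)] := t_inv; rewrite ad_mx_struct.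
move/(congr1 (map_mx h)); rewrite map_mx0 map_mxD !map_mxM -matrix.map_trmx.
suff -> : map_mx h (adm (struct_cst br el eu) a) = adm sh a by [].
by apply/matrixP => i j; rewrite !mxE.
Qed.

End MorphicStructure.

Section CotangentTensor.
Variables (F : numFieldType) (g : vectType F) (br : lie_bracket g).
Variables (l u : {vspace g}) (p q : nat) (el : p.-tuple g) (eu : q.-tuple g).
Hypotheses (bl : basis_of l el) (bu : basis_of u eu).
Hypothesis (spl : splitting br l u).
Variables (t : 'M[F]_(p + q)) (t_inv : sym_invariant br el eu t).
Variables (kappa c : F) (f : mfps F 1).
Hypothesis f_ode : cot_equation kappa (1 + X1 F * f).

Local Notation N := (p + q)%N.
Local Notation P := {mpoly F[p]}.
Local Notation M := (mfps F p).
Local Notation a := (scoef f).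
Local Notation sc := (struct_cst br el eu).
Local Notation sP := (fun x y z => (sc x y z)%:MP : P).
Local Notation tP := (map_mx (@mpolyC p F) t).
Local Notation A := (lie_mx sP (lam_vee t)).
Local Notation cM := (fun x => mfps_of x%:MP_[p]).
Local Notation sM := (fun x y z => cM (sc x y z)).
Local Notation tM := (map_mx cM t).

Local Notation antiP := (morph_anti br el eu (@mpolyC p F)).
Local Notation jacobiP := (morph_jacobi bl bu spl (@mpolyC p F)).
Local Notation symP := (morph_sym t_inv (@mpolyC p F)).
Local Notation invP := (morph_inv t_inv (@mpolyC p F)).

Lemma ad_lam_veeE : ad_lam_vee br el eu t = A.
Proof.
apply/matrixP => i j; rewrite mxE summxE; apply: eq_bigr => b _.
by rewrite !mxE -mul_mpolyC mulrC.
Qed.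

Lemma lam_vee_sum b : lam_vee t b = \sum_x tP x b * lam_gen F x.
Proof. by apply: eq_bigr => x _; rewrite mxE mul_mpolyC. Qed.

Lemma homog_sum (I : finType) d (G : I -> P) : (forall i, G i \is d.-homog) ->
  \sum_i G i \is d.-homog.
Proof. by move=> H; apply: rpred_sum => i _. Qed.

Lemma homog_constM d x (G : P) : G \is d.-homog -> x%:MP * G \is d.-homog.
Proof. by move=> H; rewrite mul_mpolyC dhomogZ. Qed.

Lemma homog_lam_vee b : lam_vee t b \is 1.-homog.
Proof.
apply: homog_sum => x; apply: dhomogZ; rewrite /lam_gen.
by case: (split x) => i; rewrite ?dhomog0 // dhomogX /= mdeg1.
Qed.

Lemma homog_lie d i j : (A ^+ d) i j \is d.-homog.
Proof.
elim: d i => [|d IHd] i.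
  by rewrite mxE; case: eqP => _; rewrite ?dhomog1 ?dhomog0.
rewrite exprS mxE; apply: homog_sum => k; rewrite -add1n; apply: dhomogM => //.
rewrite summxE; apply: homog_sum => b; rewrite !mxE mulrC.
by apply: homog_constM; apply: homog_lam_vee.
Qed.

(* [c f(c ad lam^vee)] applied to the first factor of [t]. *)
Definition phi : 'M[M]_N :=
  \matrix_(i, j) ser (fun d => (c ^+ d.+1 * a d) *: (A ^+ d *m tP) i j).

(* The derivative of [phi] when [lam^vee] moves along [e_b]. It makes sense for
   displacements of [lam] outside the dual of [l], although [phi] is only
   considered on the latter. *)
Definition dphi b : 'M[M]_N := \matrix_(i, j)
  ser (fun d => (c ^+ d.+2 * a d.+1) *:
    derp sP tP (lam_vee t) (adm sP b) d.+1 i j).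

Lemma homog_phi d i j : (c ^+ d.+1 * a d) *: (A ^+ d *m tP) i j \is d.-homog.
Proof.
apply: dhomogZ; rewrite mxE; apply: homog_sum => k; rewrite mulrC [tP _ _]mxE.
by apply: homog_constM; apply: homog_lie.
Qed.

Lemma homog_dphi b d i j : (c ^+ d.+2 * a d.+1) *:
  derp sP tP (lam_vee t) (adm sP b) d.+1 i j \is d.-homog.
Proof.
apply: dhomogZ; rewrite /derp summxE; apply: homog_sum => x.
rewrite mxE; apply: homog_sum => k; rewrite mulrC [tP _ _]mxE.
apply: homog_constM; rewrite mxE; apply: homog_sum => m.
have H1 : (A ^+ x *m adm sP b) i m \is x.-homog.
  rewrite mxE; apply: homog_sum => n; rewrite mulrC [adm _ _ _ _]mxE.
  by apply: homog_constM; apply: homog_lie.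
have := dhomogM H1 (homog_lie (d.+1.-1 - x)%N m k).
by rewrite subnKC // -ltnS.
Qed.

(** Only odd powers of [A] occur, [f] being odd, and these have skew product with the symmetric
    [t]. *)
Lemma phi_skew : phi^T = - phi.
Proof.
apply/matrixP => i j; rewrite !mxE serN; apply: eq_ser => d.
have [od|/(cot_coef_even f_ode) ->] := boolP (odd d); last first.
  by rewrite mulr0 !scale0r oppr0.
rewrite -scalerN; congr (_ *: _).
have -> : (A ^+ d *m tP) j i = ((A ^+ d *m tP)^T) i j by rewrite [RHS]mxE.
have := A_t invP (lam_vee t) d.
rewrite trmx_mul symP -signr_odd od expr1 scaleN1r => ->.
by rewrite [X in _ = - X]mxE opprK.
Qed.

Lemma phiE (L := @FracField.tofrac M) :
  loc_of c%:MP *: (map_mx L (fps_app a (c%:MP *: ad_lam_vee br el eu t))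
    *m cst_mx t) = map_mx L phi.
Proof.
have -> : cst_mx t = map_mx L tM by apply/matrixP => i j; rewrite !mxE.
rewrite -map_mxM ad_lam_veeE; apply/matrixP => i j.
rewrite [LHS]mxE [in LHS]mxE [RHS]mxE -tofracM; congr L.
have fE x y : fps_app a (c%:MP *: A) x y
    = ser (fun d => (c ^+ d * a d) *: (A ^+ d) x y).
  have pE d : ((c%:MP *: A) ^+ d) x y = c ^+ d *: (A ^+ d) x y.
    by rewrite scale_mx_expr mxE -rmorphXn /= mul_mpolyC.
  apply/mfpsP => m; rewrite mxE serE /=.
  rewrite (bigD1 ord_max) //= pE !mcoeffZ big1 => [|d ne].
    by rewrite addr0; ring.
  rewrite pE mcoeffZ (dhomog_nemf_coeff (homog_lie d x y)) ?mulr0 //.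
  by apply: contra ne => /eqP e; apply/eqP/val_inj; rewrite /= -e.
rewrite !mxE; under eq_bigr do rewrite fE mxE mulrC ser_constM.
rewrite ser_sum ser_constM; apply: eq_ser => d.
rewrite mxE !scaler_sumr; apply: eq_bigr => k _.
rewrite [tP _ _]mxE [_ * _%:MP]mulrC mul_mpolyC !scalerA exprS.
by congr (_ *: _); ring.
Qed.

Lemma lam_vee_deriv h b : (lam_vee t b)^`M(h) = (t (lshift q h) b)%:MP.
Proof.
rewrite /lam_vee mderiv_bigsum (bigD1 (lshift q h)) //= big1 => [|x ne].
  rewrite mderivZ /lam_gen split_lshift mderivX mnm1E eqxx.
  rewrite -{1}[U_(h)%MM]add0m addmK mpolyX0 scale1r addr0.
  by rewrite -mul_mpolyC mulr1.
rewrite mderivZ /lam_gen; case: (split_ordP x) ne => x' ->; last first.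
  by rewrite mderiv0 scaler0.
rewrite eq_lshift mderivX mnm1E => /negPf ne.
by rewrite ne scale0r scaler0.
Qed.

(** The chain rule: along ['X_h] the vector [lam^vee] moves with velocity [sum_b t_(b h) e_b]. *)
Lemma phi_deriv h i j :
  mfps_deriv h (phi i j) = \sum_b tM b (lshift q h) * dphi b i j.
Proof.
pose D := mderiv h : P -> P.
have DM (X Y : 'M[P]_N) : map_mx D (X *m Y) = map_mx D X *m Y + X *m map_mx D Y.
  apply/matrixP => x y; rewrite !mxE /D mderiv_bigsum -big_split.
  by apply: eq_bigr => k _; rewrite /= mderivM !mxE.
have DA : map_mx D A = \sum_b tP b (lshift q h) *: adm sP b.
  apply/matrixP => x y; rewrite mxE !summxE /D mderiv_bigsum.
  apply: eq_bigr => b _; rewrite !mxE mderivM mderivC mulr0 addr0.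
  rewrite lam_vee_deriv; have [tT _] := t_inv.
  by rewrite -{1}tT mxE.
have DP d : map_mx D (A ^+ d *m tP)
    = derp sP tP (lam_vee t) (map_mx D A) d.
  have Dt : map_mx D tP = 0.
    by apply/matrixP => x y; rewrite !mxE /D mderivC.
  rewrite DM Dt mulmx0 addr0 /derp -mulmx_suml; congr (_ *m _).
  elim: d => [|d IHd].
    rewrite big_ord0; apply/matrixP => x y; rewrite !mxE /D.
    by rewrite -mpolyC_nat mderivC.
  rewrite exprS -[A * _]/(A *m _) DM IHd big_ord_recl /= expr0 mul1mx subn0.
  congr (_ + _); rewrite mulmx_sumr; apply: eq_bigr => x _.
  rewrite /bump leq0n add1n exprS -[A * _]/(A *m _) !mulmxA.
  by congr (_ *m _ ^+ _); case: (d) x => [[]//|e] x; rewrite subSS.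
rewrite mxE deriv_ser.
under eq_bigr do rewrite !mxE ser_constM.
rewrite ser_sum; apply: eq_ser => d; rewrite mderivZ.
have := DP d.+1; rewrite DA -derp_sum => /matrixP/(_ i j); rewrite mxE => E.
rewrite -[(_ i j)^`M(h)]/(D _) E summxE scaler_sumr; apply: eq_bigr => b _.
by rewrite !mxE mul_mpolyC !scalerA mulrC.
Qed.

(** Differentiating along [[e_m, lam^vee]] is acting by [e_m], by [derp_equivariant] in each
    degree. *)
Lemma phi_equivariant m i j :
  \sum_b mfps_of (\sum_x sP m x b * lam_vee t x) * dphi b i j
  = tens_act sM m phi i j.
Proof.
have hl b : \sum_x sP m x b * lam_vee t x \is 1.-homog.
  by apply: homog_sum => x; apply: homog_constM; apply: homog_lam_vee.
under eq_bigr => b _ do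
  rewrite mxE (ser_homogM (hl b) (fun d => homog_dphi b d i j)).
rewrite ser_sum tens_actE.
under [X in _ = X + _]eq_bigr => x _ do rewrite [phi _ _]mxE ser_constM.
under [X in _ = _ + X]eq_bigr => x _ do rewrite [phi _ _]mxE mulrC ser_constM.
rewrite !ser_sum serD; apply: eq_ser => -[|d] /=.
  (* In degree 0 the left-hand side is empty and the right-hand side carries the factor
     [a 0 = 0]. *)
  rewrite big1 // (cot_coef_even f_ode) // mulr0 !big1 ?addr0 // => x _;
  by rewrite scale0r scaler0.
have E : \sum_b (\sum_x sP m x b * lam_vee t x)
      * derp sP tP (lam_vee t) (adm sP b) d.+1 i j
    = tens_act sP m (A ^+ d.+1 *m tP) i j.
  rewrite -(derp_equivariant antiP jacobiP invP) summxE.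
  by apply: eq_bigr => b _; rewrite [RHS]mxE.
transitivity ((c ^+ d.+2 * a d.+1) *: \sum_b (\sum_x sP m x b * lam_vee t x)
     * derp sP tP (lam_vee t) (adm sP b) d.+1 i j).
  rewrite scaler_sumr; apply: eq_bigr => b _.
  by rewrite subn1 -scalerAr.
rewrite E tens_actE scalerDr !scaler_sumr.
congr (_ + _); apply: eq_bigr => x _.
  by rewrite /= mul_mpolyC !scalerA mulrC.
by rewrite /= [X in _ *: X]mulrC mul_mpolyC !scalerA mulrC.
Qed.

(** Here [b] runs over all directions of [g]. In degree [d] both terms combine into [cot_weight],
    with common factor [c^(d + 2)], and [cot_weight_action] evaluates the cyclic sum. *)
Lemma phi_cyb i j k :
  cyc (fun i j k => ybr sM phi phi i j k + \sum_b tM b k * dphi b i j) i j k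
  = mfps_of (kappa * c ^+ 2)%:MP * ybr sM tM tM i j k.
Proof.
pose W x y z i j k : P := powact sP tP (lam_vee t) x y z i j k.
have E i' j' k' : ybr sM phi phi i' j' k' + \sum_b tM b k' * dphi b i' j'
   = ser (fun d => c ^+ d.+2 *:
       \sum_(x < d.+1) cot_weight f d x *: W x (d - x)%N 0%N i' j' k').
  rewrite /ybr.
  under eq_bigr => x _ do under eq_bigr => y _ do
    rewrite [phi i' x]mxE [phi j' y]mxE -mulrA
      (serM (fun d => homog_phi d i' x) (fun d => homog_phi d j' y)) ser_constM.
  under eq_bigr => x _ do rewrite ser_sum.
  rewrite ser_sum; under [X in _ + X]eq_bigr => b _ do
    rewrite [dphi _ _ _]mxE [tM _ _]mxE ser_constM.
  rewrite ser_sum serD; apply: eq_ser => d.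
  have -> : \sum_b t b k' *: (c ^+ d.+2 * a d.+1 *:
        derp sP tP (lam_vee t) (adm sP b) d.+1 i' j')
     = c ^+ d.+2 *: \sum_(x < d.+1) (- (a d.+1 * (-1) ^+ (d - x)%N)) *:
           W x (d - x)%N 0%N i' j' k'.
    transitivity ((c ^+ d.+2 * a d.+1) *: (\sum_b tP b k' *
        derp sP tP (lam_vee t) (adm sP b) d.+1 i' j')).
      rewrite scaler_sumr; apply: eq_bigr => b _.
      by rewrite [tP _ _]mxE mul_mpolyC !scalerA mulrC.
    rewrite (derp_adt antiP symP invP) scalerN -scaleNr !scaler_sumr.
    apply: eq_bigr => x _.
    rewrite -[(-1) ^+ _ : P](rmorph_sign (@mpolyC p F)) mul_mpolyC !scalerA.
    by congr (_ *: _); ring.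
  have -> : \sum_x \sum_y sc x y k' *: (\sum_(n < d.+1)
        (c ^+ n.+1 * a n *: (A ^+ n *m tP) i' x) *
        (c ^+ (d - n).+1 * a (d - n)%N *: (A ^+ (d - n) *m tP) j' y))
     = c ^+ d.+2 *: \sum_(n < d.+1) (a n * a (d - n)%N) *:
         W n (d - n)%N 0%N i' j' k'.
    rewrite scaler_sumr; under eq_bigr do under eq_bigr do rewrite scaler_sumr.
    under eq_bigr do rewrite exchange_big; rewrite exchange_big.
    apply: eq_bigr => n _; rewrite /W -(ybr_pow sP tP) /ybr !scaler_sumr.
    apply: eq_bigr => x _; rewrite !scaler_sumr; apply: eq_bigr => y _.
    have -> : c ^+ d.+2 = c ^+ n.+1 * c ^+ (d - n).+1.
      by rewrite -exprD addSn addnS subnKC // -ltnS.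
    rewrite -[in RHS]mulrA mul_mpolyC -scalerAl -scalerAr !scalerA.
    by congr (_ *: _); ring.
  rewrite -scalerDr -big_split; congr (_ *: _); apply: eq_bigr => x _ /=.
  by rewrite -scalerDl /cot_weight; congr (_ *: _); ring.
have W0 : ybr sM tM tM i j k = mfps_of (W 0%N 0%N 0%N i j k).
  rewrite /W powact000 !rmorph_sum; apply: eq_bigr => x _.
  by rewrite rmorph_sum; apply: eq_bigr => y _; rewrite !rmorphM !mxE.
have h0 : W 0%N 0%N 0%N i j k \is 0.-homog.
  rewrite /W powact000; apply: homog_sum => x; apply: homog_sum => y.
  rewrite -mulrA; apply: homog_constM; rewrite !mxE; apply: homog_constM.
  by rewrite -[_%:MP]mulr1; apply: homog_constM; apply: dhomog1.
have Wsum x y z : W x.+1 y z i j k + W x y.+1 z i j k + W x y z.+1 i j k = 0.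
  exact: (powact_sum0 antiP jacobiP symP invP (lam_vee t) x y z i j k).
have Wrot x y z i' j' k' : W x y z i' j' k' = W y z x j' k' i'.
  exact: (powact_rot antiP symP invP (lam_vee t) x y z i' j' k').
move: W W0 h0 Wsum Wrot E => W W0 h0 Wsum Wrot E.
rewrite /cyc !E W0 -rmorphM /= (mfps_of_ser (homog_constM _ h0)) !serD.
apply: eq_ser => d.
have /= EV := cot_weight_action f_ode d (W := fun x y z => W x y z i j k) Wsum.
transitivity (c ^+ d.+2 *: ((kappa *+ (d == 0%N)) *: W 0%N 0%N 0%N i j k)).
  rewrite -EV -!scalerDr -!big_split; congr (_ *: _); apply: eq_bigr => x _ /=.
  rewrite !scalerDr; congr (_ *: _ + _ *: _ + _ *: _); first by rewrite [RHS]Wrot.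
  by rewrite [RHS]Wrot [RHS]Wrot.
case: d {EV} => [|d] /=; last by rewrite mulr0n scale0r scaler0.
by rewrite mulr1n scalerA mul_mpolyC mulrC.
Qed.

End CotangentTensor.

(** * Assembly of the three parts over the fraction field *)

Section DynamicalCYBE.
Variables (F : numFieldType) (g : vectType F) (br : lie_bracket g).
Variables (l u : {vspace g}) (p q : nat) (el : p.-tuple g) (eu : q.-tuple g).
Hypotheses (bl : basis_of l el) (bu : basis_of u eu).
Hypothesis (spl : splitting br l u).
Variables (t : 'M[F]_(p + q)) (t_inv : sym_invariant br el eu t).
Variables (kappa c : F) (f : mfps F 1).
Hypothesis f_ode : cot_equation kappa (1 + X1 F * f).
Local Notation K := {fraction mfps F p}.
Variables (w : 'M[K]_q) (w_r : is_r_matrix br l u el eu w).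

Local Notation N := (p + q)%N.
Local Notation L := (@FracField.tofrac (mfps F p)).
Local Notation sc := (struct_cst br el eu).
Local Notation cK := (fun x => loc_of x%:MP_[p]).
Local Notation sK := (fun x y z => cK (sc x y z)).
Local Notation sM := (fun x y z => mfps_of (sc x y z)%:MP_[p]).
Local Notation sP := (fun x y z => (sc x y z)%:MP_[p]).
Local Notation tK := (cst_mx t).
Local Notation sg := (block_mx 0 0 0 w : 'M[K]_(p + q)).
Local Notation ph := (map_mx L (phi br el eu t c f)).
Local Notation dph b i j := (L (dphi br el eu t c f b i j)).
Local Notation hK := (@loc_of F p \o @mpolyC p F).

Lemma ybr_tofrac r r' i j k :
  L (ybr sM r r' i j k) = ybr sK (map_mx L r) (map_mx L r') i j k.
Proof.
rewrite /ybr rmorph_sum; apply: eq_bigr => a _.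
rewrite rmorph_sum; apply: eq_bigr => b _.
by rewrite /= !tofracM [map_mx L r _ _]mxE [map_mx L r' _ _]mxE.
Qed.

Lemma sg_skew : sg^T = - sg.
Proof.
have [wT _ _] := w_r.
by rewrite tr_block_mx !trmx0 wT opp_block_mx !oppr0.
Qed.

Lemma ph_skew : ph^T = - ph.
Proof.
rewrite -map_mxN -(phi_skew t_inv c f_ode).
by apply/matrixP => i j; rewrite !mxE.
Qed.

Lemma ph_act m i j : tens_act sK m ph i j =
  \sum_b (\sum_x sK m x b * \sum_z tK z x * lam_loc F z) * dph b i j.
Proof.
have := congr1 L (phi_equivariant bl bu spl t_inv c f_ode m i j).
rewrite rmorph_sum => E.
transitivity (L (tens_act sM m (phi br el eu t c f) i j)).
  rewrite !tens_actE tofracD !rmorph_sum.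
  by congr (_ + _); apply: eq_bigr => x _; rewrite /= tofracM [ph _ _]mxE.
rewrite -E; apply: eq_bigr => b _; rewrite /= tofracM; congr (_ * _).
rewrite -[LHS]/(loc_of _) rmorph_sum; apply: eq_bigr => x _.
rewrite rmorphM; congr (_ * _); rewrite lam_vee_sum rmorph_sum.
by apply: eq_bigr => z _; rewrite rmorphM [tK _ _]mxE mxE.
Qed.

(** Contraction with [r] recovers the derivatives in the directions dual to [u], which [dtens] does
    not contain. *)
Lemma ph_u_deriv i j k : \sum_m sg k m * tens_act sK m ph i j =
  (in_u k)%:R * \sum_b tK b k * dph b i j.
Proof.
under eq_bigr do rewrite ph_act mulr_sumr.
rewrite exchange_big mulr_sumr; apply: eq_bigr => b _.
rewrite mulrA -(coadjoint_invert (morph_sym t_inv hK) (morph_inv t_inv hK) k b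
  (sg_form bl bu spl w_r)).
by rewrite mulr_suml; apply: eq_bigr => m _; rewrite mulrA.
Qed.

Lemma ph_l_deriv h i j :
  frac_deriv h (ph i j) = \sum_b tK b (lshift q h) * dph b i j.
Proof.
rewrite mxE frac_deriv_tofrac (phi_deriv t_inv) rmorph_sum.
by apply: eq_bigr => b _; rewrite /= tofracM !mxE.
Qed.

Lemma ph_cyb i j k :
  cyc (fun i j k => ybr sK ph ph i j k + \sum_b tK b k * dph b i j) i j k
  = loc_of (kappa * c ^+ 2)%:MP * ybr sK tK tK i j k.
Proof.
have := congr1 L (phi_cyb bl bu spl t_inv c f_ode i j k).
have -> : tK = map_mx L (map_mx (fun x => mfps_of x%:MP_[p]) t).
  by apply/matrixP => x y; rewrite !mxE.
rewrite tofracM ybr_tofrac => <-; rewrite /cyc !tofracD !ybr_tofrac !rmorph_sum.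
by congr (_ + _ + (_ + _) + (_ + _)); apply: eq_bigr => b _;
  rewrite /= tofracM [map_mx L _ _ _]mxE.
Qed.

Lemma dtens_rho i j k : dtens (sg + ph) (i, j, k) =
  (~~ in_u k)%:R * (\sum_b tK b k * dph b i j - ybr sK sg sg i j k).
Proof.
rewrite ffunE /in_u; case: (split_ordP k) => h ->; last by rewrite mul0r.
rewrite mul1r mxE frac_derivD (sg_deriv bl bu spl w_r) ph_l_deriv.
by rewrite addrC.
Qed.

Theorem dynamical_cybe :
  let rho_c := rho br el eu (scoef f) t w c in
  CYB br el eu rho_c + Alt (dtens rho_c)
    = - loc_of (kappa * c ^+ 2)%:MP *: Ztens br el eu t.
Proof.
rewrite /rho phiE /=; apply/ffunP => -[[i j] k].
have sK_anti := morph_anti br el eu hK.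
have rho_skew : (sg + ph)^T = - (sg + ph).
  by rewrite linearD /= sg_skew ph_skew opprD.
have CYBE : CYB br el eu (sg + ph) (i, j, k)
    = cyc (ybr sK (sg + ph) (sg + ph)) i j k.
  have E1 : br1213 br el eu (sg + ph) (sg + ph) (i, j, k)
      = ybr sK (sg + ph) (sg + ph) j k i.
    by rewrite ffunE; apply: ybr1213.
  have E2 : br1223 br el eu (sg + ph) (sg + ph) (i, j, k)
      = ybr sK (sg + ph) (sg + ph) k i j.
    by rewrite ffunE; apply: ybr1223.
  have E3 : br1323 br el eu (sg + ph) (sg + ph) (i, j, k)
      = ybr sK (sg + ph) (sg + ph) i j k by rewrite ffunE.
  by rewrite /CYB ffunE [X in X + _]ffunE E1 E2 E3 addrC addrA.
have ZE : Ztens br el eu t (i, j, k) = - ybr sK tK tK i j k.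
  rewrite -(ybrC23 (morph_sym t_inv hK) (morph_inv t_inv hK)) ffunE.
  apply: eq_bigr => a _; apply: eq_bigr => b _.
  by rewrite (tC (morph_sym t_inv hK) k b).
rewrite [LHS]ffunE CYBE [RHS]ffunE ZE [Alt _ _]ffunE.
rewrite -[RHS]/(- _ * - _) mulrNN -ph_cyb.
pose T i j k := ybr sK sg ph i j k + ybr sK ph sg i j k.
(* The mixed brackets are regrouped within the cyclic sum so that each pair has the form given by
   [ybr_cross]. *)
pose T' i j k := ybr sK ph sg j k i + ybr sK sg ph k i j.
have ET : cyc T i j k = cyc T' i j k by rewrite /cyc /T /T'; ring.
have closed := ybr_closed_form i j k (sg_form bl bu spl w_r)
  (form_mx_closed (morph_jacobi bl bu spl hK) (@lam_loc F p q)).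
pose D i j k := \sum_b tK b k * dph b i j.
have ET' x y z : T' x y z = (in_u z)%:R * D x y z.
  by rewrite /T' -(ybr_cross sK_anti _ _ _ _ ph_skew) ph_u_deriv.
transitivity (cyc (fun x y z => ybr sK (sg + ph) (sg + ph) x y z
    + (~~ in_u z)%:R * (D x y z - ybr sK sg sg x y z)) i j k).
  by rewrite cycD; congr (_ + _); rewrite /cyc !dtens_rho.
(* The brackets of [r] with last index in [l] cancel against [dr]. Adding the missing
   [u]-derivatives to the cotangent part subtracts [cyc T'] from the mixed brackets. *)
transitivity (cyc (fun x y z => (in_u z)%:R * ybr sK sg sg x y z) i j k
   + (cyc T i j k - cyc T' i j k)
   + cyc (fun x y z => ybr sK ph ph x y z + D x y z) i j k); last first.
  by rewrite closed ET subrr !add0r.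
rewrite -[- cyc T' i j k]mulN1r /cyc !ET' /T !ybrD.
move: (ybr sK) D {ET'} => Y D.
by case: (in_u i); case: (in_u j); case: (in_u k); rewrite /=; ring.
Qed.

End DynamicalCYBE.

Theorem corollary0p2 (R : realType) (g : vectType R[i]) (br : lie_bracket g)
    (l u : {vspace g}) (p q : nat) (el : p.-tuple g) (eu : q.-tuple g)
    (t : 'M[R[i]]_(p + q)) (w : 'M[{fraction mfps R[i] p}]_q) (c : R[i]) :
  basis_of l el -> basis_of u eu ->
  splitting br l u -> nondegenerate_splitting br l u el ->
  sym_invariant br el eu t ->
  is_r_matrix br l u el eu w ->
  let rho_c := rho br el eu (@f_coef R) t w c in
  CYB br el eu rho_c + Alt (dtens rho_c)
    = - loc_of (piC R ^+ 2 * c ^+ 2)%:MP *: Ztens br el eu t.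
Proof.
move=> bl bu spl _ t_inv w_r.
exact: (dynamical_cybe bl bu spl t_inv c (f_cot_equation R) w_r).
Qed.
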